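(* Let $m\geq 2$, let $\{1,\dots,m\}$ be the disjoint union of $n\geq 2$ non-empty subsets $C_1,\dots,C_n$, let $Y$ be a Banach space with cotype $q$, and let $r_1,\dots,r_n\in [1,q)$, $p_1,\dots, p_n\in [1,+\infty)$. For $k=1,\dots,n$ and $J\subset\{1,\dots,n\}\setminus\{k\}$, define $$\frac{1}{\gamma_{k,J}}=\frac1{r_k}-\sum_{j\notin J\cup \{k\}}\frac{|C_j|}{p_j^*}\times\frac{1-\frac q{r_k}-\frac{q|C_k|}{p_k^*}}{1-\frac q{r_j}-\frac{q |C_j|}{p_j^*}},$$ and let $\mathbf q=(q_1,\dots,q_m)$ with $q_j=p_k$ whenever $j\in C_k$. Assume that there exists $J\subset\{1,\dots,n\}$ such that (1) there exists $k_0\in\{1,\dots,n\}\setminus J$ with $\gamma_{k_0,J}\geq q$; (2) for any $k,l\in\{1,\dots,n\}\setminus J$, $k\neq l$, $\gamma_{k,J\cup\{l\}}\in(0, q]$; (3) for any $k,l\in\{1,\dots,n\}\setminus J$, $k\neq l$, $\frac{|C_l|\gamma_{k,J\cup\{l\}}}{p_l^*}\leq 1$. Set $$\frac1s=\frac{1}{\gamma_{k_0,J}}-\sum_{j\in J}\frac{|C_j|}{p_j^*}$$ and assume that $s>0$. Then, for all Banach spaces $X_1,\dots,X_m$, every $m$-linear map $T:X_1\times\cdots\times X_m\to Y$ which is coordinatewise multiple $(r_k,p_k)$-summing in the coordinates of $C_k$ for each $k=1,\dots,n$ is multiple $(s,\mathbf q)$-summing.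
   Context: For $p\in[1,+\infty)$, $p^*$ denotes the conjugate exponent, $\frac1p+\frac1{p^*}=1$ (with $\frac1{p^*}=0$ if $p=1$). For a sequence $x=(x_i)_{i\in\mathbb N}$ in a Banach space $X$, $w_p(x)=\sup_{\|x^*\|\le1}\big(\sum_{i}|x^*(x_i)|^p\big)^{1/p}$, the supremum being over $x^*$ in the unit ball of $X^*$. For $r\ge1$ and $\mathbf p=(p_1,\dots,p_m)\in[1,+\infty)^m$, an $m$-linear map $T:X_1\times\cdots\times X_m\to Y$ between Banach spaces is multiple $(r,\mathbf p)$-summing if there is $C>0$ such that for all sequences $x(j)=(x_i(j))_{i\in\mathbb N}\subset X_j$, $1\le j\le m$, $$\Big(\sum_{\mathbf i\in\mathbb N^m}\|T(x_{i_1}(1),\dots,x_{i_m}(m))\|^r\Big)^{1/r}\le C\,w_{p_1}(x(1))\cdots w_{p_m}(x(m)).$$ If all $p_j$ equal the same $p$, one says multiple $(r,p)$-summing. For a non-empty proper subset $C\subset\{1,\dots,m\}$ with complement $\overline C$, let $X^C=\prod_{j\in C}X_j$ and identify $X_1\times\cdots\times X_m$ with $X^C\times X^{\overline C}$; for $z\in X^{\overline C}$, $T^C(z)$ is the $|C|$-linear map $X^C\to Y$, $x\mapsto T(x,z)$. $T$ is coordinatewise multiple $(r,p)$-summing in the coordinates of $C$ if $T^C(z)$ is multiple $(r,p)$-summing for every $z\in X^{\overline C}$. Cotype $q$ ($2\le q<\infty$) has its usual meaning. *)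

(* Defs.v *)
From mathcomp Require Import all_boot all_order all_algebra.
From mathcomp Require Import all_classical all_reals all_analysis.
From mathcomp Require Import complex.

Set Implicit Arguments.
Unset Strict Implicit.
Unset Printing Implicit Defensive.

Import Order.TTheory GRing.Theory Num.Theory.
Import numFieldNormedType.Exports.

Local Open Scope classical_set_scope.
Local Open Scope ring_scope.

Variant scalars := RealScalars | ComplexScalars.

Definition scalar_field (R : realType) (k : scalars) : numFieldType :=
  match k with RealScalars => R | ComplexScalars => R[i] end.

(* In MathComp-Analysis the norm of a normed space over R[i] takes its values
   in R[i]; [scalar_re] brings these values back to R. *)
Definition scalar_re (R : realType) (k : scalars) : scalar_field R k -> R :=
  match k with RealScalars => id | ComplexScalars => @complex.Re R end.

Notation banach R k := (completeNormedModType (scalar_field R k)).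

Section Summing.
Variables (R : realType) (k : scalars).
Local Notation K := (scalar_field R k).

Definition nrm (X : normedModType K) (x : X) : R := scalar_re `|x|.

(* 1 / p^*, equal to 0 when p = 1 *)
Definition inv_conj (p : R) : R := 1 - p^-1.

Definition dual_ball (X : normedModType K) : set {linear X -> K^o} :=
  [set f | forall x : X, `|f x| <= `|x|].

Definition weak_norm (X : normedModType K) (p : R) (x : nat -> X) : \bar R :=
  ereal_sup [set ((\sum_(0 <= i <oo) (nrm (f (x i)) `^ p)%:E) `^ p^-1)%E
            | f in @dual_ball X].

Definition multilinear (I : eqType) (X : I -> normedModType K)
    (Y : normedModType K) (T : (forall j, X j) -> Y) : Prop :=
  forall (x : forall j, X j) (j : I) (a : K) (u v : X j),
    T (dfwith x j (a *: u + v)) = a *: T (dfwith x j u) + T (dfwith x j v).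

(* On the right-hand side 0 * +oo = 0 in \bar R; this is harmless for a
   multilinear T, since weak_norm p x = 0 forces x = 0. *)
Definition multiple_summing (I : finType) (X : I -> normedModType K)
    (Y : normedModType K) (r : R) (p : I -> R) (T : (forall j, X j) -> Y)
    : Prop :=
  exists2 c : R, 0 < c &
    forall x : forall j, nat -> X j,
      ((\esum_(i in [set: {ffun I -> nat}])
          (nrm (T (fun j => x j (i j))) `^ r)%:E) `^ r^-1
       <= c%:E * \prod_(j : I) weak_norm (p j) (x j))%E.

(* The identification of X^A x X^(~: A) with the full product. *)
Definition glue (I : finType) (X : I -> Type) (A : {set I})
    (x : forall j : {j | j \in A}, X (val j))
    (z : forall j : {j | j \notin A}, X (val j)) (j : I) : X j :=
  match boolP (j \in A) with
  | AltTrue h => x (exist _ j h)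
  | AltFalse h => z (exist _ j h)
  end.

Definition coordinatewise_summing (I : finType) (X : I -> normedModType K)
    (Y : normedModType K) (A : {set I}) (r p : R) (T : (forall j, X j) -> Y)
    : Prop :=
  forall z : forall j : {j | j \notin A}, X (val j),
    multiple_summing (X := fun j : {j | j \in A} => X (val j)) r (fun=> p)
      (fun x => T (glue x z)).

(* Rademacher averages are written as averages over all choices of signs. *)
Definition cotype (Y : normedModType K) (q : R) : Prop :=
  exists2 c : R, 0 < c &
    forall (N : nat) (y : 'I_N -> Y),
      (\sum_(i < N) nrm (y i) `^ q) `^ q^-1 <=
      c * Num.sqrt (2 ^- N * \sum_(e : {ffun 'I_N -> bool})
                       nrm (\sum_(i < N) (-1) ^+ e i *: y i) ^+ 2).

End Summing.

Section Exponents.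
Variables (R : realType) (m n : nat) (C : 'I_n -> {set 'I_m}).
Variables (q : R) (r p : 'I_n -> R).

Definition defect (k : 'I_n) : R :=
  1 - q / r k - q * #|C k|%:R * inv_conj (p k).

Definition inv_gamma (k : 'I_n) (J : {set 'I_n}) : R :=
  (r k)^-1 - \sum_(j | j \notin J :|: [set k])
               #|C j|%:R * inv_conj (p j) * (defect k / defect j).

(* If inv_gamma k J = 0 then gamma k J = 0, so neither 0 < gamma k J nor
   q <= gamma k J (for q > 0) holds. *)
Definition gamma (k : 'I_n) (J : {set 'I_n}) : R := (inv_gamma k J)^-1.

End Exponents.

(* Main.v *)
From HB Require Import structures.
Require Import Defs.
From mathcomp Require Import all_boot all_order all_algebra.
From mathcomp Require Import all_classical all_reals all_analysis.
From mathcomp Require Import complex ring lra.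
Set Implicit Arguments.
Unset Strict Implicit.
Unset Printing Implicit Defensive.
Import Order.TTheory GRing.Theory Num.Theory.
Import numFieldNormedType.Exports.
Local Open Scope ring_scope.

(* Write a_k = |C_k| / p_k^*, d_k = 1/r_k + a_k - 1/q > 0 and let S be the sum
   of a_j / d_j over j not in J, so that 1/gamma_{k,J} = 1/q + d_k (1 - S) for
   k not in J.

   Cotype q (with Kahane-Khintchine to pass to L^1 averages), iterated over the
   coordinates outside C_k, bounds the l_{r_k}(C_k; l_q) norm of the array
   ||T(x_i)|| weighted by lambda_j(i_j), j outside C_k, by
   c * prod_j w_{q_j}(x(j)) as soon as every lambda_j is in the unit ball of
   l_{q_j^*}.  Here one needs the summing constants of T^{C_k}(z) to be at most
   M * prod_j ||z_j|| (uniform boundedness, one coordinate at a time), and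
   Hahn-Banach to see that signed sums of lambda_j x(j) have norm at most
   w_{q_j}(x(j)).

   On a finite box let P be the probability proportional to ||T(x_i)||^s and
   take lambda_j = P_j^{1/q_j^*}, with P_j the j-th marginal of P.  Jensen's
   inequality turns the mixed norm estimates into linear inequalities between
   log sum ||T(x_i)||^s, the entropy H of P and the entropies h_k <= H of its
   marginals on the blocks C_k.  The block k outside J that maximizes d_k h_k
   gives the claim, since S >= 1 and S - a_{k0} / d_{k0} <= 1. *)

(** * Scalars and norms *)

Section Scalars.
Variables (R : realType) (k : scalars).
Local Notation K := (scalar_field R k).

Definition real_scalar : {rmorphism R -> K} :=
  match k return {rmorphism R -> scalar_field R k} with
  | RealScalars => idfun
  | ComplexScalars => real_complex R
  end.

Lemma real_scalarK : cancel real_scalar (@scalar_re R k).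
Proof. by rewrite /real_scalar; case: k. Qed.

Lemma ler_real_scalar a b : (real_scalar a <= real_scalar b) = (a <= b).
Proof. by rewrite /real_scalar; case: k => //=; rewrite lecR. Qed.

Lemma ltr_real_scalar a b : (real_scalar a < real_scalar b) = (a < b).
Proof.
by rewrite !lt_def ler_real_scalar (inj_eq (can_inj real_scalarK)).
Qed.

Lemma norm_real_scalar a : `|real_scalar a| = real_scalar `|a|.
Proof. by rewrite /real_scalar; case: k => //=; rewrite normc_def /= expr0n addr0 sqrtr_sqr. Qed.

Lemma ger0_scalar_re (x : K) : 0 <= x -> x = real_scalar (scalar_re x).
Proof.
rewrite /real_scalar; move: x; case: k => //= -[a b].
by rewrite lecE /= => /andP[/eqP -> _].
Qed.

Section Norm.
Variable X : normedModType K.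
Implicit Types (x y : X).

Lemma normE x : `|x| = real_scalar (nrm x).
Proof. exact: ger0_scalar_re. Qed.

Lemma nrm_ge0 x : 0 <= nrm x.
Proof. by rewrite -ler_real_scalar -normE rmorph0. Qed.

Lemma nrm0 : nrm (0 : X) = 0.
Proof. by rewrite /nrm normr0 -(rmorph0 real_scalar) real_scalarK. Qed.

Lemma nrm_eq0 x : nrm x = 0 -> x = 0.
Proof. by move=> x0; apply: normr0_eq0; rewrite normE x0 rmorph0. Qed.

Lemma nrmN x : nrm (- x) = nrm x.
Proof. by rewrite /nrm normrN. Qed.

Lemma nrmD x y : nrm (x + y) <= nrm x + nrm y.
Proof. by rewrite -ler_real_scalar rmorphD -!normE ler_normD. Qed.

Lemma nrmB x y : nrm (x - y) <= nrm x + nrm y.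
Proof. by rewrite -(nrmN y) nrmD. Qed.

Lemma nrmZ (a : K) x : nrm (a *: x) = nrm (a : K^o) * nrm x.
Proof.
by rewrite -[RHS]real_scalarK rmorphM /nrm -!ger0_scalar_re ?normrZ.
Qed.

Lemma nrm_real_scalar (a : R) : nrm (real_scalar a : K^o) = `|a|.
Proof. by rewrite /nrm norm_real_scalar real_scalarK. Qed.

Lemma nrmZr (a : R) x : nrm (real_scalar a *: x) = `|a| * nrm x.
Proof. by rewrite nrmZ nrm_real_scalar. Qed.

Lemma nrmMsign (b : bool) x : nrm ((-1) ^+ b *: x) = nrm x.
Proof. by case: b; rewrite ?expr1 ?scaleN1r ?nrmN ?expr0 ?scale1r. Qed.

Lemma nrm_sum (I : Type) (s : seq I) (P : pred I) (F : I -> X) :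
  nrm (\sum_(i <- s | P i) F i) <= \sum_(i <- s | P i) nrm (F i).
Proof.
elim/big_rec2: _ => [|i u v _ uv]; first by rewrite nrm0.
by rewrite (le_trans (nrmD _ _))// lerD2l.
Qed.

End Norm.

(** The first hypothesis says that the closed balls of centre [u n] and radius [e n] are nested;
    completeness provides a common point. *)
Lemma complete_nrm (X : completeNormedModType K) (u : nat -> X) (e : nat -> R) :
  (forall n, nrm (u n.+1 - u n) + e n.+1 <= e n) -> (forall n, 0 <= e n) ->
  (forall eps, 0 < eps -> exists n, e n < eps) ->
  exists x, forall n, nrm (x - u n) <= e n.
Proof.
move=> ue e0 e_lim.
have ue2 n m : (n <= m)%N -> nrm (u m - u n) + e m <= e n.
  elim: m => [|m IH]; first by rewrite leqn0 => /eqP ->; rewrite subrr nrm0 add0r.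
  rewrite leq_eqVlt => /predU1P[->|/IH]; first by rewrite subrr nrm0 add0r.
  have := ue m; have := nrmD (u m.+1 - u m) (u m - u n); rewrite addrA subrK; lra.
have cau : cauchy (u n @[n --> \oo])%classic.
  apply/cauchy_ballP => eps eps0.
  have epsE := ger0_scalar_re (ltW eps0).
  have eps0' : 0 < scalar_re eps / 2.
    by rewrite divr_gt0// -ltr_real_scalar rmorph0 -epsE.
  have [n en] := e_lim _ eps0'.
  set A := [set x | exists2 m, (n <= m)%N & x = u m]%classic.
  exists (A, A); first by split; exists n => // m /= nm; exists m.
  move=> [x y] /= [[m nm ->] [m' nm' ->]].
  rewrite -ball_normE /ball_ /= normE epsE ltr_real_scalar.
  have := ue2 _ _ nm; have := ue2 _ _ nm'; have := e0 m; have := e0 m'.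
  have := nrmB (u m - u n) (u m' - u n); rewrite opprB addrA subrK; lra.
have /cvg_ex[x ux] : cvg (u n @[n --> \oo])%classic by exact/cauchy_cvgP.
exists x => n.
(* If [x] were outside the n-th ball, all later centres, which stay in that ball, would keep a
   positive distance from [x]. *)
rewrite leNgt; apply/negP => xu.
move/cvgrPdist_lt : ux => /(_ (real_scalar (nrm (x - u n) - e n))).
rewrite -(rmorph0 real_scalar) ltr_real_scalar subr_gt0 => /(_ xu).
move=> [m _ /(_ (maxn m n) (leq_maxl _ _))] /=.
rewrite normE ltr_real_scalar.
have := ue2 _ _ (leq_maxr m n); set l := maxn m n.
have := nrmD (x - u l) (u l - u n); rewrite addrA subrK; have := e0 l; lra.
Qed.

End Scalars.

(** * Norming functionals *)

Section HahnBanach.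
Variables (R : realType) (k : scalars).
Local Notation K := (scalar_field R k).
Local Notation rs := (real_scalar R k).
Variable X : normedModType K.
Implicit Types (x v : X) (a b : X * R).

Let closedG (G : set (X * R)) := forall t a b,
  G a -> G b -> G (rs t *: a.1 + b.1, t * a.2 + b.2).
Let dominatedG (G : set (X * R)) := forall a, G a -> a.2 <= nrm a.1.

(** The one-dimensional extension step of Hahn-Banach. Real-linear functionals are kept as graphs,
    so that Zorn's lemma applies to plain unions. *)
Lemma graph_extension (G : set (X * R)) v : closedG G -> dominatedG G -> G (0, 0) ->
  exists c, closedG [set (a.1 + rs t *: v, a.2 + t * c) | a in G & t in setT]%classic /\
    dominatedG [set (a.1 + rs t *: v, a.2 + t * c) | a in G & t in setT]%classic.
Proof.
move=> clG domG G0.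
(* The value at [v] has to lie between [a.2 - nrm (a.1 - v)] and [nrm (b.1 + v) - b.2] for all [a],
   [b] in the graph; [sup E] is the least such value. *)
pose E := [set a.2 - nrm (a.1 - v) | a in G]%classic.
have Eub b : G b -> ubound E (nrm (b.1 + v) - b.2).
  move=> Gb _ [a Ga <-].
  have := domG _ (clG 1 _ _ Ga Gb); rewrite /= rmorph1 scale1r mul1r.
  have := nrmD (a.1 - v) (b.1 + v); rewrite addrACA addNr addr0; lra.
have E0 : (E !=set0)%classic by exists (0 - nrm (0 - v)), (0, 0).
have supE : has_sup E by split=> //; exists (nrm (0 + v) - 0); exact: (Eub (0, 0)).
exists (sup E); split.
  move=> t _ _ [a Ga [s _ <-]] [b Gb [s' _ <-]] /=.
  exists (rs t *: a.1 + b.1, t * a.2 + b.2); first exact: clG.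
  exists (t * s + s') => //=; congr (_, _); last by ring.
  by rewrite rmorphD rmorphM scalerDr scalerA scalerDl addrACA.
have scale t a : G a -> G (rs t *: a.1, t * a.2).
  by move=> Ga; have := clG t _ _ Ga G0; rewrite /= !addr0.
move=> _ [a Ga [t _ <-]] /=.
(* Dividing by the absolute value of [t] reduces t > 0 to the upper bounds on [sup E] and t < 0 to
   the lower ones. *)
have [t0|t0|->] := ltgtP t 0; last first.
- by rewrite rmorph0 scale0r mul0r !addr0; exact: domG.
- have /(ge_sup E0) := Eub _ (scale t^-1 _ Ga) => /= h.
  have := ler_wpM2l (ltW t0) h; rewrite mulrBr mulVKf ?gt_eqF//.
  have -> : nrm (a.1 + rs t *: v) = t * nrm (rs t^-1 *: a.1 + v); last by lra.
  rewrite -[in RHS](gtr0_norm t0) -nrmZr scalerDr scalerA -rmorphM gtr0_norm//.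
  by rewrite divff ?gt_eqF// rmorph1 scale1r.
- have u0 : 0 < - t by lra.
  have : E ((- t)^-1 * a.2 - nrm (rs (- t)^-1 *: a.1 - v)).
    by exists (rs (- t)^-1 *: a.1, (- t)^-1 * a.2) => //; exact: scale.
  move=> /(ub_le_sup supE.2) h.
  have := ler_wpM2l (ltW u0) h; rewrite mulrBr mulVKf ?gt_eqF//.
  have -> : nrm (a.1 + rs t *: v) = - t * nrm (rs (- t)^-1 *: a.1 - v); last by lra.
  rewrite -[in RHS](gtr0_norm u0) -nrmZr scalerBr scalerA -rmorphM gtr0_norm//.
  by rewrite divff ?gt_eqF// rmorph1 scale1r rmorphN scaleNr opprK.
Qed.

Lemma real_hahn_banach u : exists f : X -> R,
  [/\ forall t x y, f (rs t *: x + y) = t * f x + f y,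
      forall x, f x <= nrm x & f u = nrm u].
Proof.
(* The third condition is vacuous for the empty graph, so the union of an empty chain satisfies
   [P]. *)
pose P (G : set (X * R)) :=
  [/\ closedG G, dominatedG G & forall a, G a -> G (u, nrm u)].
have [F FP totF|G [[clG domG Gu] maxG]] := @Zorn_bigcup _ P.
  split.
  - move=> t a b [A FA Aa] [B FB Bb].
    by have [AB|BA] := totF _ _ FA FB; [exists B => //; case: (FP _ FB) => + _ _
      | exists A => //; case: (FP _ FA) => + _ _]; apply => //; [exact: AB | exact: BA].
  - by move=> a [A FA Aa]; case: (FP _ FA) => _ /(_ _ Aa).
  - by move=> a [A FA Aa]; exists A => //; case: (FP _ FA) => _ _ /(_ _ Aa).
(* A maximal graph is not empty, since the graph of t u -> t [nrm u] extends the empty one. *)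
have {}Gu : G (u, nrm u).
  apply: contrapT => nGu.
  have G0 : forall a, ~ G a by move=> a /Gu.
  apply: (maxG [set (rs t *: u, t * nrm u) | t in setT]%classic).
    split; first by move=> a /G0.
    move=> /(_ (u, nrm u)) h; apply: nGu; apply: h.
    by exists 1 => //; rewrite rmorph1 scale1r mul1r.
  split.
  - move=> t _ _ [s _ <-] [s' _ <-]; exists (t * s + s') => //=.
    by rewrite rmorphD rmorphM scalerDl scalerA mulrDl mulrA.
  - by move=> _ [t _ <-] /=; rewrite nrmZr ler_wpM2r ?nrm_ge0// ler_norm.
  - by move=> _ _; exists 1 => //; rewrite rmorph1 scale1r mul1r.
have G0 : G (0, 0).
  have := clG (-1) _ _ Gu Gu.
  by rewrite /= rmorphN1 scaleN1r addNr mulN1r addNr.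
have domain v : exists c, G (v, c).
  have [c [clB domB]] := graph_extension v clG domG G0.
  have sub a : G a -> [set (a.1 + rs t *: v, a.2 + t * c) | a in G & t in setT]%classic a.
    by move=> Ga; exists a => //; exists 0 => //; rewrite rmorph0 scale0r mul0r !addr0; case: a Ga.
  exists c; apply: contrapT => nGv; apply: maxG; last first.
    split; [exact: clB | exact: domB | by move=> _ _; exact: sub].
  split; first exact: sub.
  move=> /(_ (v, c)) h; apply: nGv; apply: h; exists (0, 0) => //.
  by exists 1 => //; rewrite rmorph1 scale1r mul1r !add0r.
have unique v c c' : G (v, c) -> G (v, c') -> c = c'.
  move=> Gc Gc'; apply/eqP; rewrite eq_le.
  have := domG _ (clG (-1) _ _ Gc Gc'); have := domG _ (clG (-1) _ _ Gc' Gc).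
  rewrite /= rmorphN1 scaleN1r addNr nrm0; lra.
have [f Gf] := choice domain.
exists f; split.
- by move=> t x y; apply: unique (Gf _) _; exact: clG (Gf x) (Gf y).
- by move=> x; exact: domG (Gf x).
- exact: unique (Gf u) Gu.
Qed.

End HahnBanach.

(** In the complex case the real functional g becomes the real part of F(x) = g(x) - i g(ix), which
    is complex linear. *)
Lemma norming_functional (R : realType) (k : scalars)
    (X : normedModType (scalar_field R k)) (u : X) :
  exists2 f, dual_ball f & nrm (f u) = nrm u.
Proof.
have [g [gl g_le gu]] := real_hahn_banach u.
have gN x : g (- x) = - g x.
  have g0 : g 0 = 0 by have := gl (-1) 0 0; rewrite scaler0 addr0; lra.
  by have := gl (-1) x 0; rewrite rmorphN1 scaleN1r !addr0 g0; lra.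
case: k X u g gl g_le gu gN => X u g gl g_le gu gN.
  have glin : linear (g : X -> R^o) by move=> t x y; rewrite gl.
  pose f : {linear X -> R^o} := HB.pack (g : X -> R^o) (GRing.isLinear.Build _ _ _ _ _ glin).
  exists f; last by rewrite /nrm /= gu ger0_norm// nrm_ge0.
  move=> x; rewrite ler_norml /= g_le andbT.
  by rewrite lerNl -gN (le_trans (g_le _))// /nrm normrN.
pose ii : R[i] := (0 +i* 1)%C.
pose K := scalar_field R ComplexScalars.
pose F x : K^o := (g x +i* - g (ii *: x))%C : R[i].
have gD x y : g (x + y) = g x + g y by have := gl 1 x y; rewrite rmorph1 scale1r mul1r.
have gZ t x : g ((t%:C)%C *: x) = t * g x.
  by have := gl t x 0; rewrite addr0 => ->; have := gN 0; rewrite oppr0; lra.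
have FZ (c : K) x : F (c *: x) = c *: F x.
  case: c => a b.
  have -> : (a +i* b)%C = (a%:C + b%:C * ii)%C :> R[i].
    by apply/eqP; rewrite eq_complex /=; apply/andP; split; apply/eqP; ring.
  rewrite /F !scalerDl scalerDr !gD !scalerA.
  have -> : ii * ((b%:C)%C * ii) = ((- b)%:C)%C.
    by apply/eqP; rewrite eq_complex /=; apply/andP; split; apply/eqP; ring.
  rewrite [ii * _]mulrC -!scalerA !gZ.
  by apply/eqP; rewrite eq_complex /=; apply/andP; split; apply/eqP; ring.
have Flin : linear F.
  move=> c x y; rewrite -FZ /F scalerDr !gD.
  by apply/eqP; rewrite eq_complex /=; apply/andP; split; apply/eqP; ring.
pose f : {linear X -> K^o} := HB.pack F (GRing.isLinear.Build _ _ _ _ _ Flin).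
have fb : dual_ball f.
  move=> x; rewrite (normE (F x)) (normE x) ler_real_scalar.
  have [Fx0|Fx0] := eqVneq (F x) 0; first by rewrite Fx0 nrm0 nrm_ge0.
  (* The unimodular [c] rotates [F x] to its modulus, which then equals g(c x) and is at most the
     norm of x. *)
  pose c : K := `|F x| / F x.
  have cn : `|c| = 1 by rewrite normrM normfV normr_id divff ?normr_eq0.
  have cF : F (c *: x) = `|F x| by rewrite FZ /c -[LHS]/(_ * _) divfK.
  have <- : g (c *: x) = nrm (F x) by exact: (congr1 (@complex.Re R) cF).
  have cn1 : nrm (c : K^o) = 1 by rewrite /nrm cn -(rmorph1 (real_scalar R ComplexScalars)) real_scalarK.
  by rewrite (le_trans (g_le _))// nrmZ cn1 mul1r.
exists f => //; apply/eqP; rewrite eq_le.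
have := fb u; rewrite (normE (f u)) (normE u) ler_real_scalar => ->; rewrite andTb -gu.
have -> : nrm (f u) = Num.sqrt (g u ^+ 2 + (- g (ii *: u)) ^+ 2) by [].
by rewrite (le_trans (ler_norm _))// -sqrtr_sqr ler_wsqrtr// lerDl sqr_ge0.
Qed.

(** * Uniform boundedness *)

Section UniformBoundedness.
Variables (R : realType) (k : scalars).
Local Notation K := (scalar_field R k).
Local Notation rs := (real_scalar R k).

Definition bounded_seminorm (X : normedModType K) (f : X -> R) :=
  [/\ forall u v, f (u + v) <= f u + f v,
      forall t u, f (rs t *: u) = `|t| * f u &
      exists L, forall u, f u <= L * nrm u].

Lemma bounded_seminorm0 (X : normedModType K) (f : X -> R) :
  bounded_seminorm f -> f 0 = 0.
Proof. by case=> _ fZ _; rewrite -(scaler0 _ (rs 0)) fZ normr0 mul0r. Qed.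

Lemma bounded_seminormN (X : normedModType K) (f : X -> R) u :
  bounded_seminorm f -> f (- u) = f u.
Proof.
by case=> _ fZ _; rewrite -scaleN1r -(rmorphN1 rs) fZ normrN1 mul1r.
Qed.

Lemma bounded_seminorm_scale (X : normedModType K) (f : X -> R) (c : R) :
  0 <= c -> bounded_seminorm f -> bounded_seminorm (fun u => f u * c).
Proof.
move=> c0 [fD fZ [L fL]]; split.
- by move=> u v; rewrite -mulrDl ler_wpM2r.
- by move=> t u; rewrite fZ mulrA.
- by exists (L * c) => u; rewrite mulrAC ler_wpM2r.
Qed.

(** Since 2 f(v) <= f(x + v) + f(x - v), one of the points x + v, x - v has a value at least f(v),
    and f(v) can be made large with v of length d / 2. *)
Lemma unbounded_subball (X : normedModType K) (F : set (X -> R)) :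
  (forall f, F f -> bounded_seminorm f) ->
  ~ (exists2 M, 0 <= M & forall f, F f -> forall u, f u <= M * nrm u) ->
  forall (n : nat) (x : X) (d : R), 0 < d -> exists x' d',
    [/\ 0 < d', d' <= d / 2, nrm (x' - x) + d' <= d &
        exists2 f, F f & forall y, nrm (y - x') <= d' -> n%:R <= f y].
Proof.
move=> Fs unb n x d d0.
have [f [u [Ff fu]]] : exists f u, F f /\ 2 * n.+1%:R / d * nrm u < f u.
  apply: contrapT => h; apply: unb; exists (2 * n.+1%:R / d).
    by rewrite divr_ge0// ?mulr_ge0// ltW.
  move=> f Ff u; rewrite leNgt; apply/negP => fu; apply: h; by exists f, u.
have sf := Fs _ Ff; have [fD fZ [L fL]] := sf.
have u0 : 0 < nrm u.
  rewrite lt_neqAle nrm_ge0 andbT eq_sym; apply/eqP => /nrm_eq0 u0.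
  by move: fu; rewrite u0 nrm0 mulr0 bounded_seminorm0// ltxx.
pose v := rs (d / 2 / nrm u) *: u.
have c0 : 0 < d / 2 / nrm u by rewrite !divr_gt0.
have vE : nrm v = d / 2 by rewrite nrmZr gtr0_norm// divfK// gt_eqF.
have fv : n.+1%:R <= f v.
  rewrite fZ gtr0_norm//.
  have := ler_wpM2l (ltW c0) (ltW fu); congr (_ <= _).
  by field; rewrite !gt_eqF.
have [x' xx' fx'] : exists2 x', nrm (x' - x) = d / 2 & n.+1%:R <= f x'.
  have [h|h] := leP n.+1%:R (f (x + v)).
    by exists (x + v) => //; rewrite addrAC subrr add0r.
  exists (x - v); first by rewrite addrAC subrr add0r nrmN.
  rewrite leNgt; apply/negP => h'.
  have : f (v + v) = 2 * f v.
    have := fZ 2 v; rewrite [rs 2]rmorphD rmorph1 scalerDl scale1r => ->.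
    by rewrite ger0_norm.
  have := fD (x + v) (- (x - v)).
  have -> : x + v - (x - v) = v + v by rewrite opprB addrC addrA addrNK.
  rewrite bounded_seminormN//; move: fv; rewrite -natr1; lra.
(* On a ball of this radius [f] varies by at most 1, so [n.+1] at the centre leaves [n] on the
   ball. *)
pose d' := Num.min (d / 2) (`|L| + 1)^-1.
have d'0 : 0 < d' by rewrite lt_min divr_gt0//= invr_gt0 ltr_wpDl.
have d'd : d' <= d / 2 by rewrite ge_min lexx.
exists x', d'; split=> //; first by rewrite xx'; lra.
exists f => // y yx'.
have := fD y (- (y - x')); have -> : y - (y - x') = x' by rewrite opprB addrC addrNK.
rewrite bounded_seminormN// => fxy.
suff fyx' : f (y - x') <= 1 by move: fx'; rewrite -natr1; lra.
rewrite (le_trans (fL _))//.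
have d'L : d' * (`|L| + 1) <= 1.
  by rewrite -ler_pdivlMr ?ltr_wpDl// div1r ge_min lexx orbT.
apply: le_trans d'L; rewrite mulrC (le_trans (ler_wpM2l (nrm_ge0 _) (ler_norm L)))//.
by rewrite ler_pM ?nrm_ge0// lerDl.
Qed.

(** Nested balls take the place of Baire's theorem: the n-th step finds a ball on which some member
    of [F] is at least n, so [F] would be unbounded at a common point. *)
Lemma uniform_boundedness (X : completeNormedModType K) (F : set (X -> R)) :
  (forall f, F f -> bounded_seminorm f) ->
  (forall u, exists M, forall f, F f -> f u <= M) ->
  exists2 M, 0 <= M & forall f, F f -> forall u, f u <= M * nrm u.
Proof.
move=> Fs Fb; apply: contrapT => unb.
(* The step is made total, with a dummy value at nonpositive radii, so that [choice] applies. *)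
have step (t : nat * (X * R)) : exists s : X * R, 0 < t.2.2 ->
    [/\ 0 < s.2, s.2 <= t.2.2 / 2, nrm (s.1 - t.2.1) + s.2 <= t.2.2 &
        exists2 f, F f & forall y, nrm (y - s.1) <= s.2 -> t.1%:R <= f y].
  have [d0|d0] := ltP 0 t.2.2; last by exists (0, 0); lra.
  have [x' [d' h]] := unbounded_subball Fs unb t.1 t.2.1 d0.
  by exists (x', d').
have [next nextP] := choice step.
pose s := fix s n := if n is n'.+1 then next (n', s n') else (0, 1).
have s0 n : 0 < (s n).2 by elim: n => [|n /(nextP (n, s n))[]].
have sP n := nextP (n, s n) (s0 n).
have s_lim eps : 0 < eps -> exists n, (s n).2 < eps.
  move=> eps0.
  have s_le n : (s n).2 * 2 ^+ n <= 1.
    elim: n => [|n IH]; first by rewrite expr0 mulr1.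
    have [_ h _ _] := sP n; apply: le_trans IH; rewrite exprS mulrA.
    by rewrite ler_wpM2r ?exprn_ge0//; move: h => /=; lra.
  exists (Num.truncn eps^-1).+1; set n := _.+1.
  have ltn : eps^-1 < 2 ^+ n.
    rewrite (lt_le_trans (truncnS_gt _))// -natrX ler_nat ltnW// ltn_expl//.
  have p0 : 0 < 2 ^+ n :> R by rewrite exprn_gt0.
  rewrite -(ltr_pM2r p0) (le_lt_trans (s_le n))//.
  by rewrite -ltr_pdivrMl// mulr1.
have [x xP] := @complete_nrm _ _ X (fun n => (s n).1) (fun n => (s n).2)
  (fun n => let: And4 _ _ h _ := sP n in h) (fun n => ltW (s0 n)) s_lim.
have [M FM] := Fb x.
have [_ _ _ [f Ff fn]] := sP (Num.truncn M).+1.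
have /= := fn x (xP _.+1).
have := FM _ Ff; have := truncnS_gt M; lra.
Qed.

End UniformBoundedness.

(** Induction on [D]: the sections in one coordinate, divided by the product of the remaining norms,
    are pointwise bounded by the induction hypothesis, and uniform boundedness applies to them. *)
Lemma multilinear_uniform_boundedness (R : realType) (k : scalars) (I : eqType)
    (X : I -> completeNormedModType (scalar_field R k))
    (F : set ((forall j, X j) -> R)) (D : seq I) :
  uniq D ->
  (forall S, F S -> forall z j, j \in D ->
     bounded_seminorm (fun u => S (dfwith z j u))) ->
  (forall z, exists M, forall S, F S -> S z <= M) ->
  forall z : forall j, X j, exists2 M, 0 <= M & forall S, F S -> forall z',
    (forall j, j \notin D -> z' j = z j) -> S z' <= M * \prod_(j <- D) nrm (z' j).
Proof.
elim: D => [_ _ Fb z|j D IH /= /andP[jD uD] Fs Fb z].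
  have [M FM] := Fb z; exists `|M| => // S FS z' zz'.
  have -> : z' = z by apply: functional_extensionality_dep => j; exact: zz'.
  by rewrite big_nil mulr1 (le_trans (FM _ FS))// ler_norm.
have FsD S : F S -> forall z j', j' \in D -> bounded_seminorm (fun u => S (dfwith z j' u)).
  by move=> FS z' j' j'D; apply: Fs => //; rewrite inE j'D orbT.
have {}IH := IH uD FsD Fb.
have prodE (z' : forall j, X j) (u : X j) :
    \prod_(i <- D) nrm (dfwith z' j u i) = \prod_(i <- D) nrm (z' i).
  apply: eq_big_seq => i iD; rewrite dfwithout//.
  by apply: contraNneq jD => ->.
pose F' := [set f | exists S z', [/\ F S, forall i, i \notin j :: D -> z' i = z i &
  f = fun u => S (dfwith z' j u) * (\prod_(i <- D) nrm (z' i))^-1]]%classic.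
have prod_ge0 (z' : forall j, X j) : 0 <= \prod_(i <- D) nrm (z' i).
  by apply: prodr_ge0 => i _; exact: nrm_ge0.
have agree z' u i : (forall i, i \notin j :: D -> z' i = z i) -> i \notin D ->
    dfwith z' j u i = dfwith z j u i.
  move=> zz' iD; have [ij|ij] := eqVneq j i; first by case: _ / ij; rewrite !dfwithin.
  by rewrite !dfwithout// zz'// inE negb_or eq_sym ij.
have [_ [S [z' [FS zz' ->]]]|u|M M0 FM] := @uniform_boundedness R k (X j) F'.
- apply: (@bounded_seminorm_scale R k (X j) (fun u => S (dfwith z' j u))).
    by rewrite invr_ge0; exact: prod_ge0.
  by apply: Fs => //; exact: mem_head.
- have [M M0 FM] := IH (dfwith z j u).
  exists M => _ [S [z' [FS zz' ->]]].
  have := FM _ FS (dfwith z' j u) (fun i => agree z' u i zz'); rewrite prodE => h.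
  have [->|P0] := eqVneq (\prod_(i <- D) nrm (z' i)) 0; first by rewrite invr0 mulr0.
  by rewrite ler_pdivrMr// lt_neqAle eq_sym P0; exact: prod_ge0.
exists M => // S FS z' zz'; rewrite big_cons.
have z'E : z' = dfwith z' j (z' j).
  by apply: functional_extensionality_dep => i; case: dfwithP.
(* When the product vanishes the normalized section is lost, but the induction hypothesis already
   bounds [S z'] by 0. *)
have [P0|P0] := eqVneq (\prod_(i <- D) nrm (z' i)) 0.
  have [M' _ FM'] := IH (dfwith z j (z' j)).
  have := FM' _ FS (dfwith z' j (z' j)) (fun i => agree z' (z' j) i zz').
  by rewrite prodE P0 -z'E !mulr0.
rewrite {1}z'E mulrA -ler_pdivrMr; last by rewrite lt_neqAle eq_sym P0; exact: prod_ge0.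
by apply: (FM (fun u => S (dfwith z' j u) * _)); exists S, z'.
Qed.

(** * Power means *)

Section PowerMeans.
Variable R : realType.
Implicit Types p q t : R.

Lemma le_powRl t x y : 0 <= t -> 0 <= x -> x <= y -> x `^ t <= y `^ t.
Proof. by move=> t0 x0 xy; apply: ge0_ler_powR; rewrite ?nnegrE// (le_trans x0). Qed.

(** The tangent line at 1, obtained from Young's inequality for [t] and 1. *)
Lemma bernoulli_powR p t : 1 <= p -> 0 <= t -> 1 + p * (t - 1) <= t `^ p.
Proof.
rewrite le_eqVlt => /predU1P[<- t0|p1 t0]; first by rewrite powRr1//; lra.
have p0 : 0 < p by lra.
have q0 : 0 < (1 - p^-1)^-1 by rewrite invr_gt0 subr_gt0 invf_lt1.
have := @conjugate_powR R t 1 p (1 - p^-1)^-1 t0 ler01 p0 q0.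
rewrite invrK addrC subrK powR1 mulr1 mul1r => /(_ erefl) /(ler_wpM2l (ltW p0)).
rewrite mulrDr mulrBr mulfV ?gt_eqF// mulrCA mulfV ?gt_eqF//; lra.
Qed.

(** Jensen's inequality, by summing the tangent line inequality at the mean. *)
Lemma powR_mean (I : finType) (w a : I -> R) p : 1 <= p ->
  (forall i, 0 <= w i) -> \sum_i w i = 1 -> (forall i, 0 <= a i) ->
  (\sum_i w i * a i) `^ p <= \sum_i w i * a i `^ p.
Proof.
move=> p1 w0 w1 a0; set m := \sum_i _.
have wa0 i : 0 <= w i * a i `^ p by rewrite mulr_ge0 ?powR_ge0.
have [m0|m0] := leP m 0.
  have -> : m = 0 by apply/eqP; rewrite eq_le m0 sumr_ge0// => i _; rewrite mulr_ge0.
  by rewrite powR0 ?sumr_ge0//; lra.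
have -> : m `^ p = \sum_i w i * (m `^ p * (1 + p * (a i / m - 1))).
  rewrite (eq_bigr (fun i => m `^ p * (1 - p) * w i + m `^ p * p / m * (w i * a i))).
    rewrite big_split -!mulr_sumr w1 -/m /=; field; exact: lt0r_neq0.
  by move=> i _; field; exact: lt0r_neq0.
apply: ler_sum => i _; apply: ler_wpM2l => //.
have -> : a i `^ p = m `^ p * (a i / m) `^ p.
  have am0 : 0 <= a i / m by rewrite divr_ge0// ltW.
  by rewrite -(powRM _ (ltW m0) am0) mulrC divfK ?lt0r_neq0.
by rewrite ler_wpM2l ?powR_ge0// bernoulli_powR ?divr_ge0// ltW.
Qed.

Lemma powRKV t q : q != 0 -> 0 <= t -> (t `^ q) `^ q^-1 = t.
Proof. by move=> q0 t0; rewrite -powRrM mulfV// powRr1. Qed.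

Lemma powRVK t q : q != 0 -> 0 <= t -> (t `^ q^-1) `^ q = t.
Proof. by move=> q0 t0; rewrite -powRrM mulVf// powRr1. Qed.

Lemma sum_powR_eq0 (I : finType) (a : I -> R) q : 0 < q -> (forall i, 0 <= a i) ->
  \sum_i a i `^ q = 0 -> forall i, a i = 0.
Proof.
move=> q0 a0 /eqP; rewrite psumr_eq0 => [/allP h i|i _]; last exact: powR_ge0.
by apply: powR_eq0_eq0 (eqP (h i _)); rewrite mem_index_enum.
Qed.

(** With [A j] the norm of column j and [B] their sum, each row sum is [B] times the mean of
    [F i j / A j] with weights [A j / B]; Jensen's inequality then applies row by row. *)
Lemma minkowski_sum (I J : finType) (F : I -> J -> R) q : 1 <= q ->
  (forall i j, 0 <= F i j) ->
  (\sum_i (\sum_j F i j) `^ q) `^ q^-1 <= \sum_j (\sum_i F i j `^ q) `^ q^-1.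
Proof.
move=> q1 F0; have q0 : 0 < q by lra.
have qn0 := lt0r_neq0 q0.
pose A j := (\sum_i F i j `^ q) `^ q^-1; rewrite -/(\sum_j A j).
have A0 j : 0 <= A j by exact: powR_ge0.
have S0 j : 0 <= \sum_i F i j `^ q by apply: sumr_ge0 => i _; exact: powR_ge0.
have FA j : A j = 0 -> forall i, F i j = 0.
  by move=> /powR_eq0_eq0 h; exact: sum_powR_eq0 q0 (F0 ^~ j) h.
set B := \sum_j A j.
have B0 : 0 <= B by exact: sumr_ge0.
have [Bz|Bn0] := eqVneq B 0.
  have AZ j : A j = 0.
    by move/eqP : Bz; rewrite psumr_eq0// => /allP/(_ j); rewrite mem_index_enum => /(_ isT)/eqP.
  rewrite big1 ?powR0 ?invr_eq0// => i _.
  by rewrite big1 ?powR0// => j _; exact: FA.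
have Bp : 0 < B by rewrite lt_neqAle eq_sym Bn0.
suff h : \sum_i (\sum_j F i j) `^ q <= B `^ q.
  rewrite -[leRHS](@powRKV _ q)//; apply: le_powRl => //; first by rewrite invr_ge0 ltW.
  by apply: sumr_ge0 => i _; exact: powR_ge0.
have Fi i : (\sum_j F i j) `^ q <= B `^ q * \sum_j A j / B * (F i j / A j) `^ q.
  rewrite (_ : \sum_j F i j = B * \sum_j A j / B * (F i j / A j)); last first.
    rewrite mulr_sumr; apply: eq_bigr => j _.
    have [Az|An] := eqVneq (A j) 0; first by rewrite Az FA// !(mul0r, mulr0).
    by field; rewrite Bn0 An.
  have w0 i' j : 0 <= F i' j / A j by rewrite divr_ge0.
  have v0 j : 0 <= A j / B by rewrite divr_ge0.
  rewrite powRM// ?sumr_ge0// => [|j _]; last by rewrite mulr_ge0.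
  rewrite ler_wpM2l ?powR_ge0// powR_mean//.
  by rewrite -mulr_suml divff.
apply: le_trans (ler_sum _ (fun i _ => Fi i)) _.
rewrite -mulr_sumr ler_piMr ?powR_ge0// exchange_big /=.
apply: (@le_trans _ _ (\sum_j A j / B)); last by rewrite -mulr_suml divff.
apply: ler_sum => j _; rewrite -mulr_sumr ler_piMr ?divr_ge0//.
have [Az|An] := eqVneq (A j) 0.
  by rewrite Az big1 // => i _; rewrite invr0 mulr0 powR0.
rewrite (eq_bigr (fun i => F i j `^ q / A j `^ q)) => [|i _].
  rewrite -mulr_suml /A powRVK// divff//.
  by apply: contraNneq An => h; rewrite /A h powR0 ?invr_eq0.
by rewrite powRM ?invr_ge0// -powR_inv1// powRAC powR_inv1 ?powR_ge0.
Qed.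

Lemma minkowski_cond (B : finType) (P : pred B) (f g : B -> R) r : 1 <= r ->
  (forall a, 0 <= f a) -> (forall a, 0 <= g a) ->
  (\sum_(a | P a) (f a + g a) `^ r) `^ r^-1 <=
  (\sum_(a | P a) f a `^ r) `^ r^-1 + (\sum_(a | P a) g a `^ r) `^ r^-1.
Proof.
move=> r1 f0 g0; have r0 : r != 0 by rewrite gt_eqF//; lra.
have := @minkowski_sum B bool (fun a b => if P a then (if b then f a else g a) else 0) r r1.
have E (h : B -> R) : \sum_(a | P a) h a `^ r = \sum_a (if P a then h a else 0) `^ r.
  by rewrite big_mkcond; apply: eq_bigr => a _; case: ifP => //; rewrite powR0.
rewrite big_bool /= !E.
under eq_bigr do rewrite big_bool /=.
have -> : \sum_i ((if P i then f i else 0) + (if P i then g i else 0)) `^ r =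
          \sum_i (if P i then f i + g i else 0) `^ r.
  by apply: eq_bigr => a _; case: ifP => //; rewrite addr0.
by apply => a b; case: ifP => //; case: b.
Qed.

End PowerMeans.

(** * Kahane-Khintchine inequality *)

Section Walsh.
Variables (R : realType) (N : nat).
Local Notation G := {ffun 'I_N -> bool}.
Implicit Types (e S : G) (f g : G -> R).

(** The characters of the cube, with [S] the indicator of a subset. The coefficients carry no factor
    2^-N, whence the 2^N in [walsh_parseval]. *)
Definition walsh S e : R := \prod_i (-1) ^+ (S i && e i).
Definition walsh_coef f S : R := \sum_e walsh S e * f e.
Definition flip (i : 'I_N) e : G := [ffun j => (j == i) (+) e j].
Definition negate e : G := [ffun j => ~~ e j].

Lemma walsh_orthogonal e e' :
  \sum_S walsh S e * walsh S e' = if e == e' then 2 ^+ N else 0.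
Proof.
under eq_bigr do rewrite -big_split /=.
rewrite -(bigA_distr_bigA (fun i (b : bool) => (-1) ^+ (b && e i) * (-1) ^+ (b && e' i))) /=.
under eq_bigr do rewrite big_bool /= mulr1 -signr_addb.
case: eqVneq => [<-|].
  under eq_bigr do rewrite addbb expr0.
  by rewrite prodr_const card_ord.
have [h|/forallPn[i ei] _] := boolP [forall i, e i == e' i].
  by move=> /eqP[]; apply/ffunP => i; exact/eqP/(forallP h).
rewrite (bigD1 i) //= (_ : e i (+) e' i) ?expr0 ?expr1 ?addNr ?mul0r//.
by move: ei; case: (e i); case: (e' i).
Qed.

Lemma walsh_parseval f g :
  \sum_S walsh_coef f S * walsh_coef g S = 2 ^+ N * \sum_e f e * g e.
Proof.
under eq_bigr do rewrite big_distrlr /=.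
rewrite exchange_big mulr_sumr; apply: eq_bigr => e _ /=.
rewrite exchange_big (bigD1 e)//= [X in _ + X]big1 ?addr0 => [|e' ee'].
  under eq_bigr do rewrite mulrACA.
  by rewrite -mulr_suml walsh_orthogonal eqxx.
under eq_bigr do rewrite mulrACA.
by rewrite -mulr_suml walsh_orthogonal eq_sym (negPf ee') mul0r.
Qed.

Lemma flipK i : involutive (flip i).
Proof. by move=> e; apply/ffunP => j; rewrite !ffunE addbA addbb. Qed.

Lemma negateK : involutive negate.
Proof. by move=> e; apply/ffunP => j; rewrite !ffunE negbK. Qed.

Lemma walsh_coef_flip f i S :
  walsh_coef (f \o flip i) S = (-1) ^+ S i * walsh_coef f S.
Proof.
rewrite /walsh_coef (reindex_inj (inv_inj (flipK i))) mulr_sumr /=.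
apply: eq_bigr => e _; rewrite flipK mulrA; congr (_ * _).
rewrite /walsh (bigD1 i)//= [in RHS](bigD1 i)//= mulrA; congr (_ * _).
  by rewrite ffunE eqxx -signr_addb; case: (S i); case: (e i).
by apply: eq_bigr => j ji; rewrite ffunE (negPf ji).
Qed.

(** Negating every sign multiplies the character by (-1)^|S|. *)
Lemma walsh_coef_even f S : (forall e, f (negate e) = f e) ->
  \prod_i (-1) ^+ S i = -1 :> R -> walsh_coef f S = 0.
Proof.
move=> f_even oddS.
suff : walsh_coef f S = - walsh_coef f S by lra.
rewrite {1}/walsh_coef (reindex_inj (inv_inj negateK)) /walsh_coef -mulN1r mulr_sumr /=.
apply: eq_bigr => e _; rewrite f_even mulrA -oddS; congr (_ * _).
rewrite /walsh -big_split; apply: eq_bigr => i _; rewrite /= ffunE -signr_addb.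
by case: (S i); case: (e i).
Qed.

(* Even functions have no Walsh coefficient of level 1, so the spectral gap of
   the flip operator doubles. *)
Lemma flip_form_le f : (forall e, f (negate e) = f e) ->
  \sum_e \sum_i f e * f (flip i e) <=
  (N%:R - 4) * \sum_e f e ^+ 2 + 4 * 2 ^- N * (\sum_e f e) ^+ 2.
Proof.
move=> f_even.
have p0 : 0 < 2 ^+ N :> R by rewrite exprn_gt0.
rewrite -(ler_pM2l p0).
(* The characters diagonalize the flip operator, with eigenvalue N - 2|S| at [S]. *)
have -> : 2 ^+ N * (\sum_e \sum_i f e * f (flip i e)) =
    \sum_(S : G) (\sum_i (-1) ^+ S i) * walsh_coef f S ^+ 2.
  rewrite exchange_big mulr_sumr /=.
  under eq_bigr do rewrite -(walsh_parseval f (f \o flip _)).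
  rewrite exchange_big; apply: eq_bigr => S _ /=; rewrite mulr_suml.
  by apply: eq_bigr => i _; rewrite walsh_coef_flip; ring.
have f0 : walsh_coef f [ffun=> false] = \sum_e f e.
  by apply: eq_bigr => e _; rewrite /walsh big1 ?mul1r// => i _; rewrite ffunE.
have -> : 2 ^+ N * ((N%:R - 4) * (\sum_e f e ^+ 2) + 4 * 2 ^- N * (\sum_e f e) ^+ 2) =
    \sum_(S : G) ((N%:R - 4) * walsh_coef f S ^+ 2 +
            4 * (if S == [ffun=> false] then walsh_coef f S ^+ 2 else 0)).
  rewrite big_split /= -!mulr_sumr -big_mkcond big_pred1_eq f0.
  under [in RHS]eq_bigr do rewrite expr2.
  rewrite walsh_parseval mulrDr mulrCA; congr (_ + _).
  by field; exact: lt0r_neq0.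
apply: ler_sum => S _.
pose m := (\sum_i S i)%N.
have sumE : \sum_i (-1) ^+ S i = N%:R - 2 * m%:R :> R.
  have -> : N%:R = \sum_(i < N) 1 :> R by rewrite sumr_const card_ord.
  rewrite /m natr_sum mulr_sumr -sumrB.
  by apply: eq_bigr => i _; case: (S i); rewrite /= ?expr1 ?expr0; lra.
have prodE : \prod_i (-1) ^+ S i = (-1) ^+ m :> R by rewrite /m prodrXr.
rewrite sumE; case: eqVneq => [S0|S0].
  have -> : m = 0%N by rewrite /m S0 big1// => i _; rewrite ffunE.
  by have := sqr_ge0 (walsh_coef f S); nra.
(* Level 0, where N = (N - 4) + 4, is settled; level 1 vanishes by evenness; from level 2 on the
   eigenvalue is at most N - 4. *)
have [m1|m2|m1] := ltngtP m 1.
- case/eqP : S0; apply/ffunP => i; rewrite ffunE.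
  move: m1; rewrite ltnS leqn0 /m sum_nat_eq0 => /forallP/(_ i).
  by case: (S i).
- have := sqr_ge0 (walsh_coef f S); have : 2 <= m%:R :> R by rewrite (ler_nat _ 2).
  nra.
- by rewrite walsh_coef_even ?prodE ?m1 ?expr1// expr2 !mulr0 addr0.
Qed.

End Walsh.

Section Khintchine.
Variables (R : realType) (k : scalars) (Y : normedModType (scalar_field R k)).

Definition signed_sum N (y : 'I_N -> Y) (e : {ffun 'I_N -> bool}) : Y :=
  \sum_(i < N) (-1) ^+ e i *: y i.

(* Latala and Oleszkiewicz: summing the signed sums over the neighbours of a
   vertex e returns N - 2 times the signed sum at e. *)
Lemma kahane_khintchine N (y : 'I_N -> Y) :
  2 ^+ N * \sum_e nrm (signed_sum y e) ^+ 2 <= 2 * (\sum_e nrm (signed_sum y e)) ^+ 2.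
Proof.
set f := fun e => nrm (signed_sum y e).
have f_even e : f (negate e) = f e.
  rewrite /f -nrmN; congr nrm; rewrite /signed_sum -sumrN; apply: eq_bigr => i _.
  by rewrite ffunE signrN scaleNr opprK.
have f_flip e : (N%:R - 2) * f e <= \sum_i f (flip i e).
  apply: (@le_trans _ _ (nrm (\sum_i signed_sum y (flip i e)))); last exact: nrm_sum.
  suff -> : \sum_i signed_sum y (flip i e) = real_scalar R k (N%:R - 2) *: signed_sum y e.
    by rewrite nrmZr ler_wpM2r ?nrm_ge0// ler_norm.
  rewrite exchange_big scaler_sumr; apply: eq_bigr => j _ /=.
  rewrite -scaler_suml scalerA; congr (_ *: _).
  (* One flip reverses the sign of [y j] and the other N - 1 keep it, which gives the coefficient N
     - 2. *)
  rewrite (bigD1 j)//= ffunE eqxx signrN.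
  rewrite (eq_bigr (fun=> (-1) ^+ e j)) => [|i ij]; last first.
    by rewrite ffunE eq_sym (negPf ij).
  have NE : N%:R = #|[pred i | i != j]|%:R + 1 :> scalar_field R k.
    rewrite natr1; congr _%:R; rewrite -[LHS](card_ord N) (cardD1 j).
    by congr (_ + _)%N; apply: eq_card => i; rewrite !inE andbT.
  rewrite sumr_const rmorphB !rmorph_nat NE -mulr_natr.
  by ring.
have := flip_form_le f_even.
have p0 : 0 < 2 ^+ N :> R by rewrite exprn_gt0.
have : \sum_e (N%:R - 2) * f e ^+ 2 <= \sum_e \sum_i f e * f (flip i e).
  apply: ler_sum => e _; rewrite -mulr_sumr expr2 mulrCA.
  by rewrite ler_wpM2l// nrm_ge0.
rewrite -mulr_sumr => /le_trans h /h{h}; rewrite -/f.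
set A := \sum_e f e ^+ 2; set B := _ ^+ 2 => h.
(* The gap between N - 2 and N - 4 leaves twice the sum of squares on the left. *)
have {}h : 2 * A <= 4 * 2 ^- N * B by move: h; lra.
have := ler_wpM2l (ltW p0) h.
rewrite !mulrA (mulrC (2 ^+ N) 4) mulfK ?gt_eqF//; lra.
Qed.

(** With plain means, averages over successive coordinates combine into one. Kahane-Khintchine costs
    a factor sqrt 2, rounded up to 2. *)
Lemma cotype_L1 q : cotype Y q ->
  exists2 c : R, 0 < c & forall N (y : 'I_N -> Y),
    (\sum_(i < N) nrm (y i) `^ q) `^ q^-1 <=
    c * (2 ^- N * \sum_e nrm (signed_sum y e)).
Proof.
move=> [c c0 hc]; exists (c * 2) => [|N y]; first by rewrite mulr_gt0.
apply: le_trans (hc N y) _; rewrite -mulrA ler_wpM2l ?(ltW c0)//.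
have p0 : 0 < 2 ^+ N :> R by rewrite exprn_gt0.
have p1 : 0 <= 2 ^- N :> R by rewrite invr_ge0 ltW.
have s0 : 0 <= \sum_e nrm (signed_sum y e) by apply: sumr_ge0 => e _; exact: nrm_ge0.
rewrite -[leRHS]ger0_norm ?mulr_ge0// -sqrtr_sqr ler_wsqrtr//.
have := ler_wpM2l p1 (ler_wpM2l p1 (kahane_khintchine y)).
rewrite mulKf ?gt_eqF// => /le_trans; apply.
rewrite !exprMn; set S := (\sum_e _) ^+ 2; set d := 2 ^- N.
have : 0 <= d * (d * S) by rewrite !mulr_ge0// sqr_ge0.
rewrite !expr2; nra.
Qed.

End Khintchine.

(** * Entropy of mixed norms *)

Section Entropy.
Variables (R : realType) (O : finType) (P : O -> R).
Hypotheses (P_ge0 : forall w, 0 <= P w) (P_sum : \sum_w P w = 1).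

(** Nonnegativity of relative entropy for an unnormalized density, from ln x <= x - 1 at x = v / (P
    V). *)
Lemma gibbs (v : O -> R) : (forall w, 0 <= v w) -> (forall w, P w != 0 -> v w != 0) ->
  \sum_w P w * (ln (v w) - ln (P w)) <= ln (\sum_w v w).
Proof.
move=> v0 vP; set V := \sum_w v w.
have V0 : 0 < V.
  rewrite lt_neqAle sumr_ge0// andbT eq_sym psumr_eq0//.
  apply/allPn; have [w Pw] : exists w, P w != 0.
    apply: contrapT => h; move: P_sum; rewrite big1 => [/esym/eqP|w _]; first by rewrite oner_eq0.
    by apply: contrapT => /eqP Pw; apply: h; exists w.
  by exists w; [exact: mem_index_enum | exact: vP].
rewrite -subr_le0 -[ln V]mul1r -P_sum mulr_suml -sumrB.
apply: (@le_trans _ _ (\sum_w (v w / V - P w))); last first.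
  rewrite sumrB -mulr_suml -/V divff ?gt_eqF// P_sum. by rewrite subrr.
apply: ler_sum => w _.
have [Pw|Pw] := eqVneq (P w) 0; first by rewrite Pw !mul0r !subr0 divr_ge0// ltW.
have vw : 0 < v w by rewrite lt_neqAle eq_sym vP// v0.
have P0 : 0 < P w by rewrite lt_neqAle eq_sym Pw P_ge0.
have -> : P w * (ln (v w) - ln (P w)) - P w * ln V = P w * ln (v w / (P w * V)).
  by rewrite ln_div ?posrE ?mulr_gt0// lnM ?posrE//; ring.
have x0 : 0 < v w / (P w * V) by rewrite divr_gt0// mulr_gt0.
have -> : v w / V - P w = P w * (v w / (P w * V) - 1) by field; rewrite Pw gt_eqF.
rewrite ler_wpM2l//.
by have := @le_ln1Dx R (v w / (P w * V) - 1); rewrite [1 + _]addrC subrK; apply; lra.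
Qed.

Definition marginal (A : finType) (pi : O -> A) a := \sum_(w | pi w == a) P w.

(** The Shannon entropy of the law of [pi], written as a sum over [O] so that different maps compare
    termwise. *)
Definition entropy (A : finType) (pi : O -> A) :=
  - \sum_w P w * ln (marginal pi (pi w)).

Lemma marginal_ge0 (A : finType) (pi : O -> A) a : 0 <= marginal pi a.
Proof. exact: sumr_ge0. Qed.

Lemma marginal_sum (A : finType) (pi : O -> A) : \sum_a marginal pi a = 1.
Proof. by rewrite -P_sum (partition_big pi predT). Qed.

Lemma le_marginal (A B : finType) (pi : O -> A) (sigma : O -> B) w :
  (forall w', pi w' = pi w -> sigma w' = sigma w) ->
  marginal pi (pi w) <= marginal sigma (sigma w).
Proof.
move=> pis; rewrite /marginal [leRHS](bigID (fun w' => pi w' == pi w)) /=.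
rewrite ler_wpDr ?sumr_ge0// le_eqVlt; apply/orP; left; apply/eqP/eq_bigl => w'.
by case: eqP => [/pis ->|]; rewrite ?eqxx ?andbT ?andbF.
Qed.

Lemma marginal_id w : marginal id w = P w.
Proof. exact: big_pred1_eq. Qed.

Lemma marginal_gt0 (A : finType) (pi : O -> A) w :
  P w != 0 -> 0 < marginal pi (pi w).
Proof.
move=> Pw; have := @le_marginal _ _ id pi w (fun w' e => congr1 pi e).
by apply: lt_le_trans; rewrite marginal_id lt_neqAle eq_sym Pw P_ge0.
Qed.

(** A map that factors through [pi] has larger fibres, hence larger marginals. *)
Lemma le_entropy (A B : finType) (pi : O -> A) (sigma : O -> B) :
  (forall w w', pi w = pi w' -> sigma w = sigma w') -> entropy sigma <= entropy pi.
Proof.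
move=> pis; rewrite lerN2; apply: ler_sum => w _.
have [->|Pw] := eqVneq (P w) 0; first by rewrite !mul0r.
by rewrite ler_wpM2l// ler_ln ?posrE ?marginal_gt0// le_marginal// => w' /pis.
Qed.

Lemma sum_marginal (A : finType) (pi : O -> A) (h : A -> R) :
  \sum_a marginal pi a * h a = \sum_w P w * h (pi w).
Proof.
rewrite [RHS](partition_big pi predT)//=; apply: eq_bigr => a _.
by rewrite mulr_suml; apply: eq_bigr => w /eqP ->.
Qed.

End Entropy.

Section MixedNorm.
Variables (R : realType) (O A : finType) (P : O -> R) (pi : O -> A).
Hypotheses (P_ge0 : forall w, 0 <= P w) (P_sum : \sum_w P w = 1).

(* Gibbs on O for the density g F(pi)^(u-1) and on A for F^u, with F the sum
   of g along the fibres; the terms in ln F cancel in the combination with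
   weights u and 1 - u. *)
Lemma mixed_norm_entropy (g : O -> R) u : 0 < u <= 1 ->
  (forall w, 0 <= g w) -> (forall w, P w != 0 -> g w != 0) ->
  u * (\sum_w P w * ln (g w) + entropy P id) + (1 - u) * entropy P pi <=
  ln (\sum_a (\sum_(w | pi w == a) g w) `^ u).
Proof.
move=> /andP[u0 u1] g0 gP.
pose F a := \sum_(w | pi w == a) g w; rewrite -/(\sum_a F a `^ u).
have F0 a : 0 <= F a by exact: sumr_ge0.
have Fpi w : g w <= F (pi w).
  by rewrite /F (bigD1 w)//= lerDl sumr_ge0.
have FP w : P w != 0 -> 0 < F (pi w).
  by move=> /gP gw; rewrite (lt_le_trans _ (Fpi w))// lt_neqAle eq_sym gw g0.
pose v w := g w * F (pi w) `^ (u - 1).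
have vE : \sum_w v w = \sum_a F a `^ u.
  rewrite (partition_big pi predT)//=; apply: eq_bigr => a _.
  rewrite -(mulr_powRB1 (F0 a) u0) mulr_suml.
  by apply: eq_bigr => w /eqP; rewrite /v => ->.
have h1 : \sum_w P w * (ln (v w) - ln (P w)) <= ln (\sum_a F a `^ u).
  rewrite -vE; apply: gibbs => // w; first by rewrite mulr_ge0// powR_ge0.
  by move=> Pw; rewrite mulf_neq0 ?gP// gt_eqF// powR_gt0 ?FP.
have h2 : \sum_a marginal P pi a * (ln (F a `^ u) - ln (marginal P pi a)) <=
          ln (\sum_a F a `^ u).
  apply: gibbs; [exact: marginal_ge0 | exact: marginal_sum | by move=> a; exact: powR_ge0 |].
  move=> a Pa; rewrite gt_eqF// powR_gt0//.
  have [w /eqP <- Pw] : exists2 w, pi w == a & P w != 0; last exact: FP.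
    apply: contrapT => h; move/eqP: Pa; apply; apply: big1 => w wa.
    by apply: contrapT => /eqP Pw; apply: h; exists w.
move: h1 h2; rewrite sum_marginal.
have -> : \sum_w P w * (ln (v w) - ln (P w)) =
    \sum_w P w * ln (g w) + (u - 1) * \sum_w P w * ln (F (pi w)) + entropy P id.
  rewrite /entropy mulr_sumr -sumrN -!big_split /=; apply: eq_bigr => w _.
  have [->|Pw] := eqVneq (P w) 0; first by rewrite !mul0r; ring.
  rewrite marginal_id lnM ?posrE ?powR_gt0 ?FP//; last first.
    by rewrite lt_neqAle eq_sym gP// g0.
  by rewrite ln_powR; ring.
have -> : \sum_w P w * (ln (F (pi w) `^ u) - ln (marginal P pi (pi w))) =
    u * (\sum_w P w * ln (F (pi w))) + entropy P pi.
  rewrite /entropy mulr_sumr -sumrN -!big_split /=; apply: eq_bigr => w _.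
  by rewrite ln_powR; ring.
move=> /(ler_wpM2l (ltW u0)) h1 /(ler_wpM2l (_ : 0 <= 1 - u)).
by rewrite subr_ge0 => /(_ u1); move: h1; lra.
Qed.

End MixedNorm.

(** * Choice of the block *)

Section ExponentChoice.
Variables (R : realType) (m n : nat) (C : 'I_n -> {set 'I_m}).
Variables (q : R) (r p : 'I_n -> R).
Hypotheses (hq : 2 <= q) (hr : forall k, 1 <= r k < q) (hp : forall k, 1 <= p k).

Let a l := #|C l|%:R * inv_conj (p l).
Let d l := (r l)^-1 + a l - q^-1.

Let a_ge0 l : 0 <= a l.
Proof. by rewrite mulr_ge0// subr_ge0 invf_le1// (lt_le_trans ltr01). Qed.

Let d_gt0 l : 0 < d l.
Proof.
have /andP[r1 rq] := hr l.
have : q^-1 < (r l)^-1 by rewrite ltf_pV2 ?posrE//; lra.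
have := a_ge0 l; rewrite /d; lra.
Qed.

(** [defect] is -q d, so ratios of defects are ratios of d. The term j = k, added to the sum, equals
    a_k and turns 1/r_k into 1/q + d_k. *)
Lemma inv_gammaE (k : 'I_n) (J : {set 'I_n}) : k \notin J ->
  inv_gamma C q r p k J = q^-1 + d k * (1 - \sum_(j | j \notin J) a j / d j).
Proof.
move=> kJ; have qn0 : q != 0 by rewrite gt_eqF// (lt_le_trans _ hq).
have rn0 l : r l != 0 by have /andP[r1 _] := hr l; rewrite gt_eqF//; lra.
have dE l : defect C q r p l = - q * d l by rewrite /defect /d /a; field; rewrite qn0 rn0.
have dn0 l := lt0r_neq0 (d_gt0 l).
rewrite (bigD1 k)//= mulrBr mulrDr mulr1 [d k * (a k / _)]mulrC divfK//.
rewrite {1}/d mulr_sumr /inv_gamma opprD !addrA.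
rewrite (_ : q^-1 + _ + _ - _ - _ = (r k)^-1); last by ring.
congr (_ - _); apply: eq_big => [j|j _]; first by rewrite !inE negb_or.
by rewrite !dE -/(a j); field; rewrite qn0 dn0.
Qed.

(* The optimal block maximizes d_k h_k outside J. *)
Lemma exists_block (J : {set 'I_n}) (k0 : 'I_n) (s H : R) (h : 'I_n -> R) :
  k0 \notin J -> q <= gamma C q r p k0 J ->
  (forall k l, k \notin J -> l \notin J -> k != l ->
     0 < gamma C q r p k (l |: J) <= q) ->
  s = ((gamma C q r p k0 J)^-1 - \sum_(j in J) a j)^-1 ->
  (forall l, h l <= H) ->
  exists k, H / s + \sum_(l | l != k) a l * h l <= H / q + ((r k)^-1 - q^-1) * h k.
Proof.
move=> k0J h1 h2 -> hH; rewrite invrK /gamma invrK.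
have q0 : 0 < q by rewrite (lt_le_trans _ hq).
have g0 : 0 < inv_gamma C q r p k0 J by rewrite -invr_gt0 (lt_le_trans q0).
have gq : inv_gamma C q r p k0 J <= q^-1 by rewrite -[leLHS]invrK lef_pV2 ?posrE ?invr_gt0.
pose S := \sum_(j | j \notin J) a j / d j.
have gE k : k \notin J -> inv_gamma C q r p k J = q^-1 + d k * (1 - S) by exact: inv_gammaE.
have S1 : 1 <= S.
  by move: gq; rewrite gE// gerDl pmulr_rle0 ?d_gt0// subr_le0.
have c_ge0 l : 0 <= a l / d l by rewrite divr_ge0// ltW.
pose c0 := a k0 / d k0.
have SE : S = c0 + \sum_(j | (j \notin J) && (j != k0)) a j / d j by rewrite /S (bigD1 k0).
(* If [k0] were alone outside [J], then 1/gamma would be 1/r_{k0}, which exceeds 1/q. *)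
have [k1 k1J k10] : exists2 k1, k1 \notin J & k1 != k0.
  apply: contrapT => none; move: gq; rewrite gE// SE big1 => [|j /andP[jJ jk]]; last first.
    by case: none; exists j.
  rewrite addr0 mulrBr mulr1 [d k0 * _]mulrC divfK ?gt_eqF//.
  have /andP[r1 rq] := hr k0.
  have : q^-1 < (r k0)^-1 by rewrite ltf_pV2 ?posrE//; lra.
  rewrite /d; lra.
(* Moving [k0] into [J] removes [c0] from [S]; the bound is the second assumption on gamma for the
   pair [k1], [k0]. *)
have Sc : S - c0 <= 1.
  have /andP[gp] := h2 _ _ k1J k0J k10.
  rewrite /gamma -[leRHS]invrK lef_pV2 ?posrE ?invr_gt0//; last by rewrite -invr_gt0.
  have k1J' : k1 \notin k0 |: J by rewrite !inE negb_or k10.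
  rewrite inv_gammaE// lerDl pmulr_rge0 ?d_gt0// subr_ge0 SE addrAC subrr add0r.
  congr (_ <= _); apply: eq_bigl => j; by rewrite !inE negb_or andbC.
have [k kJ kmax] : exists2 k, k \notin J & forall j, j \notin J -> d j * h j <= d k * h k.
  exists [arg max_(k > k0 | k \notin J) d k * h k]%O.
    by case: arg_maxP.
  by move=> j jJ; case: arg_maxP => // i _; apply.
exists k; set M := d k * h k in kmax *.
have aJ : \sum_(l in J) a l * h l <= (\sum_(l in J) a l) * H.
  by rewrite mulr_suml; apply: ler_sum => l _; rewrite ler_wpM2l.
have aN : \sum_(l | l \notin J) a l * h l <= c0 * (d k0 * h k0) + (S - c0) * M.
  rewrite (bigD1 k0)//= lerD//; first by rewrite /c0 mulrA divfK ?gt_eqF.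
  rewrite SE addrAC subrr add0r mulr_suml; apply: ler_sum => l /andP[lJ _].
  have -> : a l * h l = a l / d l * (d l * h l) by rewrite mulrA divfK ?gt_eqF.
  by rewrite ler_wpM2l// kmax.
have split_sum : \sum_(l | l != k) a l * h l =
    \sum_(l in J) a l * h l + \sum_(l | l \notin J) a l * h l - a k * h k.
  have <- : \sum_l a l * h l = \sum_(l in J) a l * h l + \sum_(l | l \notin J) a l * h l.
    by rewrite (bigID (mem J)).
  by rewrite [in RHS](bigD1 k)//= addrAC subrr add0r.
(* Put x = d_{k0} h_{k0} <= M. Then c0 x + (S - c0) M <= M + (S - 1) x by S - c0 <= 1, and (S - 1) x
   <= (S - 1) d_{k0} H by S >= 1. *)
have M0 := kmax _ k0J.
have h0 := ler_wpM2l (ltW (d_gt0 k0)) (hH k0).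
have e1 : (1 - (S - c0)) * (d k0 * h k0) <= (1 - (S - c0)) * M by rewrite ler_wpM2l// subr_ge0.
have e2 : (S - 1) * (d k0 * h k0) <= (S - 1) * (d k0 * H) by rewrite ler_wpM2l// subr_ge0.
have ME : M = (r k)^-1 * h k + a k * h k - q^-1 * h k by rewrite /M /d; ring.
rewrite split_sum gE//; move: aJ aN e1 e2 ME; lra.
Qed.

End ExponentChoice.

(** * Weak norms and finite arrays *)

Section WeakNorms.
Variables (R : realType) (k : scalars).
Local Notation K := (scalar_field R k).
Local Open Scope ereal_scope.

Lemma lee_root (S V : \bar R) (r : R) : (0 < r)%R -> 0 <= S -> 0 <= V ->
  (S `^ r^-1 <= V) = (S <= V `^ r).
Proof.
move=> r0 S0 V0; have rn0 := lt0r_neq0 r0; have ri0 : (0 < r^-1)%R by rewrite invr_gt0.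
have mono (t : R) (x y : \bar R) : (0 < t)%R -> 0 <= x -> 0 <= y -> x <= y -> x `^ t <= y `^ t.
  by move=> t0 x0 y0; apply: gt0_ler_poweR; rewrite ?in_itv/= ?x0 ?y0 ?leey// ltW.
apply/idP/idP => h.
  by rewrite -[S]poweRe1// -(mulVf rn0) poweRrM mono// poweR_ge0.
by rewrite -[V]poweRe1// -(mulfV rn0) poweRrM mono// poweR_ge0.
Qed.

Variable X : normedModType K.
Implicit Types (p W : R).

(* w_p(x) <= W. *)
Definition weakly_bounded N p W (x : 'I_N.+1 -> X) : Prop :=
  (0 <= W)%R /\ forall f, @dual_ball R k X f -> (\sum_i nrm (f (x i)) `^ p <= W `^ p)%R.

Lemma dual_ball_nrm (f : {linear X -> K^o}) u : @dual_ball R k X f -> (nrm (f u) <= nrm u)%R.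
Proof. by move=> /(_ u); rewrite (normE (f u)) (normE u) ler_real_scalar. Qed.

Lemma dual_ball0 : @dual_ball R k X \0%R.
Proof. by move=> u; rewrite /= normr0 normr_ge0. Qed.

(** One-term sequences, on which the summing inequality expresses separate continuity. *)
Lemma weakly_bounded_singleton N p (u : X) : (1 <= p)%R ->
  @weakly_bounded N p (nrm u) (fun i => if i == ord0 then u else 0%R).
Proof.
move=> p1; split=> [|f fb]; first exact: nrm_ge0.
rewrite (bigD1 ord0)//= big1 ?addr0 => [|i i0]; last first.
  by rewrite (negPf i0) linear0 nrm0 powR0//; lra.
by apply: le_powRl; [lra | exact: nrm_ge0 | exact: dual_ball_nrm].
Qed.

Lemma weak_norm_ge0 p (x : nat -> X) : 0 <= weak_norm p x.
Proof.
apply: le_trans (ereal_sup_ubound _); last by exists \0%R; [exact: dual_ball0 | reflexivity].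
exact: poweR_ge0.
Qed.

Definition extend_by0 N (x : 'I_N.+1 -> X) (i : nat) : X :=
  if (i < N.+1)%N then x (inord i) else 0%R.

Lemma weak_norm_extend N p W (x : 'I_N.+1 -> X) : (1 <= p)%R ->
  weakly_bounded p W x -> weak_norm p (extend_by0 x) <= W%:E.
Proof.
move=> p1 [W0 xW]; have p0 : (0 < p)%R by lra.
apply: ge_ereal_sup => _ [f fb <-].
have t0 i : 0 <= (nrm (f (extend_by0 x i)) `^ p)%:E by rewrite lee_fin powR_ge0.
rewrite lee_root ?lee_fin ?nneseries_ge0// poweR_EFin.
apply: lime_le; first exact: is_cvg_nneseries.
exists N.+1 => // l /= Nl.
rewrite (big_cat_nat (leq0n _) Nl)/= [X in _ + X]big_nat.
rewrite [X in _ + X]big1 => [|i /andP[Ni _]]; last first.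
  by rewrite /extend_by0 ltnNge Ni /= linear0 nrm0 powR0// gt_eqF.
rewrite adde0 big_mkord sumEFin lee_fin; apply: le_trans (xW _ fb).
by apply: ler_sum => i _; rewrite /extend_by0 ltn_ord inord_val.
Qed.

(** The bound [W] is real even when the weak norm is infinite: over finitely many terms the supremum
    is finite. *)
Lemma weakly_bounded_restrict N p (x : nat -> X) : (1 <= p)%R ->
  exists2 W, weakly_bounded p W (fun i : 'I_N.+1 => x i) & W%:E <= weak_norm p x.
Proof.
move=> p1; have p0 : (0 < p)%R by lra.
pose S (f : {linear X -> K^o}) : R := (\sum_(i < N.+1) nrm (f (x i)) `^ p)%R.
pose E := [set (S f `^ p^-1)%R | f in @dual_ball R k X]%classic.
have S0 f : (0 <= S f)%R by apply: sumr_ge0 => i _; exact: powR_ge0.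
have supE : has_sup E.
  split; first by exists (S \0 `^ p^-1)%R; exists \0%R => //; exact: dual_ball0.
  exists ((\sum_(i < N.+1) nrm (x i) `^ p) `^ p^-1)%R => _ [f fb <-].
  apply: le_powRl => [||]; [by rewrite invr_ge0 ltW | exact: S0 | apply: ler_sum => i _].
  by apply: le_powRl; [exact: ltW | exact: nrm_ge0 | exact: dual_ball_nrm].
have supP f : @dual_ball R k X f -> (S f `^ p^-1 <= sup E)%R.
  by move=> fb; apply: ub_le_sup supE.2 _ _; exists f.
exists (sup E); first split.
- by apply: le_trans (supP _ dual_ball0); exact: powR_ge0.
- move=> f fb; rewrite -/(S f) -[leLHS](@powRVK _ _ p) ?gt_eqF//.
  by apply: le_powRl; [exact: ltW | exact: powR_ge0 | exact: supP].
have wfin (V : R) : weak_norm p x = V%:E -> (sup E <= V)%R.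
  move=> wV; apply: ge_sup supE.1 _ => _ [f fb <-].
  rewrite -lee_fin -wV -poweR_EFin.
  apply: le_trans (ereal_sup_ubound _); last by exists f.
  have h0 i : (0 <= i)%N -> true -> 0 <= (nrm (f (x i)) `^ p)%:E by rewrite lee_fin powR_ge0.
  rewrite lee_root ?invr_gt0 ?poweR_ge0 ?lee_fin ?S0// -poweRrM mulVf ?gt_eqF//.
  rewrite poweRe1 ?nneseries_ge0//; apply: le_trans (nneseries_lim_ge N.+1 h0).
  by rewrite big_mkord sumEFin.
have := weak_norm_ge0 p x; case: (weak_norm p x) wfin => // [V|_ _]; last by rewrite leey.
by move=> /(_ V erefl); rewrite lee_fin.
Qed.

Local Close Scope ereal_scope.

(* For p = 1 the weights are all 1, including where Q i = 0, since 0 `^ 0 = 1. *)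
Lemma nrm_signed_sum_le N p W (x : 'I_N.+1 -> X) (Q : 'I_N.+1 -> R)
    (e : {ffun 'I_N.+1 -> bool}) : (1 <= p)%R -> weakly_bounded p W x ->
  (forall i, 0 <= Q i)%R -> (\sum_i Q i = 1)%R ->
  (nrm (signed_sum (fun i => real_scalar R k (Q i `^ inv_conj p) *: x i) e) <= W)%R.
Proof.
move=> p1 [W0 xW] Q0 Q1; have p0 : (0 < p)%R by lra.
have [f fb <-] := norming_functional
  (signed_sum (fun i => real_scalar R k (Q i `^ inv_conj p) *: x i) e).
apply: (@le_trans _ _ (\sum_i Q i `^ inv_conj p * nrm (f (x i)))%R).
  rewrite linear_sum; apply: le_trans (nrm_sum _ _ _) _; apply: ler_sum => i _.
  by rewrite !linearZ nrmMsign nrmZr ger0_norm ?powR_ge0.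
have S0 : (0 <= \sum_i Q i `^ inv_conj p * nrm (f (x i)))%R.
  by apply: sumr_ge0 => i _; rewrite mulr_ge0 ?powR_ge0 ?nrm_ge0.
have h : ((\sum_i Q i `^ inv_conj p * nrm (f (x i))) `^ p <= W `^ p)%R.
  have [p_1|pn1] := eqVneq p 1%R.
    have := xW _ fb; rewrite p_1 !powRr1//.
      congr (_ <= _)%R; apply: eq_bigr => i _.
      by rewrite /inv_conj invr1 subrr powRr0 mul1r powRr1// nrm_ge0.
    by rewrite -p_1.
  have ic : (inv_conj p != 0)%R.
    by rewrite subr_eq0 eq_sym invr_eq1.
  (* Writing Q^(1 - 1/p) as Q times Q^(-1/p) lets Jensen's inequality with weights [Q] play the part
     of Hölder's. *)
  pose a i : R := (Q i `^ (- p^-1) * nrm (f (x i)))%R.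
  have a0 i : (0 <= a i)%R by rewrite mulr_ge0 ?powR_ge0 ?nrm_ge0.
  have -> : (\sum_i Q i `^ inv_conj p * nrm (f (x i)) = \sum_i Q i * a i)%R.
    apply: eq_bigr => i _; rewrite /a mulrA; congr (_ * _)%R.
    have [->|Qi] := eqVneq (Q i) 0%R; first by rewrite powR0// mul0r.
    by rewrite /inv_conj powRD ?Qi ?implybT// powRr1.
  apply: le_trans (powR_mean p1 Q0 Q1 a0) (le_trans _ (xW _ fb)).
  apply: ler_sum => i _.
  have [->|Qi] := eqVneq (Q i) 0%R; first by rewrite mul0r powR_ge0.
  rewrite /a powRM ?powR_ge0 ?nrm_ge0// -powRrM mulNr mulVf ?gt_eqF//.
  by rewrite powR_inv1// mulrA divff// mul1r.
rewrite -[leLHS](@powRKV _ _ p) ?gt_eqF// -[leRHS](@powRKV _ _ p) ?gt_eqF//.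
by apply: le_powRl => //; [rewrite invr_ge0 ltW | exact: powR_ge0].
Qed.

End WeakNorms.

(* Multi-indices on A are encoded as the multi-indices on I that vanish off A. *)
Definition block_restriction (I : finType) (N : nat) (A : {set I})
    (w : {ffun I -> 'I_N.+1}) : {ffun I -> 'I_N.+1} :=
  [ffun j => if j \in A then w j else ord0].

(** [glue] for families defined on all of [I], which avoids subtypes. *)
Definition mix (I : finType) (X : I -> Type) (A : {set I}) (u z : forall j, X j) j : X j :=
  if j \in A then u j else z j.

Lemma glue_mix (I : finType) (X : I -> Type) (A : {set I}) (u z : forall j, X j) :
  Defs.glue (fun j : {j | j \in A} => u (val j)) (fun j : {j | j \notin A} => z (val j)) =
  mix A u z.
Proof.
apply: functional_extensionality_dep => j; rewrite /Defs.glue /mix.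
by case: {-}_ / (boolP (j \in A)) => [h|h]; rewrite ?h ?(negPf h).
Qed.

Section FiniteForms.
Variables (R : realType) (k : scalars).
Local Notation K := (scalar_field R k).

Lemma lee_prod (I : Type) (s : seq I) (P : pred I) (a b : I -> \bar R) :
  (forall i, P i -> 0 <= a i)%E -> (forall i, P i -> a i <= b i)%E ->
  (\prod_(i <- s | P i) a i <= \prod_(i <- s | P i) b i)%E.
Proof.
move=> a0 ab; elim: s => [|i s IH]; first by rewrite !big_nil.
rewrite !big_cons; case: ifP => // Pi.
by rewrite lee_pmul ?a0 ?ab// prode_ge0.
Qed.

Lemma prodEFin (I : Type) (s : seq I) (P : pred I) (b : I -> R) :
  (\prod_(i <- s | P i) (b i)%:E = (\prod_(i <- s | P i) b i)%:E)%E.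
Proof.
elim: s => [|i s IH]; first by rewrite !big_nil.
by rewrite !big_cons IH; case: ifP.
Qed.

Lemma prod_sig (I : finType) (A : {set I}) (b : I -> R) :
  \prod_(i : {j | j \in A}) b (val i) = \prod_(j in A) b j.
Proof.
rewrite [RHS](@reindex_omap _ _ _ _ _ (val : {j | j \in A} -> I) insub) => [|j jA].
  by apply: eq_bigl => u; rewrite (valP u) valK eqxx.
by rewrite insubT.
Qed.

Lemma coordinatewise_finite (I : finType) (X : I -> normedModType K) (Y : normedModType K)
    (A : {set I}) (r p : R) (T : (forall j, X j) -> Y) : 1 <= p -> 0 < r ->
  coordinatewise_summing A r p T ->
  forall z, exists2 c, 0 < c & forall N (x : forall j, 'I_N.+1 -> X j) (W : I -> R),
    (forall j, j \in A -> weakly_bounded p (W j) (x j)) ->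
    \sum_(a : {ffun I -> 'I_N.+1} | block_restriction A a == a)
      nrm (T (mix A (fun j => x j (a j)) z)) `^ r <= (c * \prod_(j in A) W j) `^ r.
Proof.
move=> p1 r0 TA z.
have [c c0 hc] := TA (fun j => z (val j)); exists c => // N x W xW.
have := hc (fun j => extend_by0 (x (val j))).
set S := esum _ _; set V := (c%:E * _)%E => SV.
have S0 : (0 <= S)%E by apply: esum_ge0 => i _; rewrite lee_fin powR_ge0.
have VW : (V <= (c * \prod_(j in A) W j)%:E)%E.
  rewrite EFinM -prod_sig -prodEFin lee_pmul ?lee_fin ?(ltW c0)//.
    by apply: prode_ge0 => i _; exact: weak_norm_ge0.
  apply: lee_prod => -[j jA] _; first exact: weak_norm_ge0.
  exact: weak_norm_extend p1 (xW _ jA).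
have W0 : 0 <= \prod_(j in A) W j by apply: prodr_ge0 => j /xW[].
have : (S <= ((c * \prod_(j in A) W j) `^ r)%:E)%E.
  rewrite -poweR_EFin -lee_root ?lee_fin ?mulr_ge0// ?(ltW c0)//.
  exact: le_trans SV VW.
rewrite -lee_fin; apply: le_trans.
(* [psi] is injective on the multi-indices that vanish off [A], so the finite sum is a subsum of
   [S]. *)
pose psi (a : {ffun I -> 'I_N.+1}) : {ffun {j | j \in A} -> nat} :=
  [ffun j => a (val j) : nat].
pose fibre := [seq a <- index_enum {ffun I -> 'I_N.+1} | block_restriction A a == a].
have psi_inj : {in fibre &, injective psi}.
  move=> a b; rewrite !mem_filter => /andP[/eqP <- _] /andP[/eqP <- _] /ffunP ab.
  apply/ffunP => j; rewrite !ffunE; case: ifP => // jA.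
  by apply: val_inj; have := ab (exist _ j jA); rewrite !ffunE /= jA.
apply: esum_ge; exists [set` map psi fibre]%classic; first by split; [exact: finite_seq|].
rewrite -fsbig_seq; last by rewrite map_inj_in_uniq// filter_uniq// index_enum_uniq.
rewrite big_map big_filter -sumEFin le_eqVlt; apply/orP; left; apply/eqP.
apply: eq_bigr => a _; rewrite -glue_mix; congr ((nrm (T (Defs.glue _ _)) `^ r)%:E).
apply: functional_extensionality_dep => j.
by rewrite ffunE /extend_by0 ltn_ord inord_val.
Qed.

(** The full sum is a supremum over finite sets of multi-indices, each contained in a box, and [c]
    is the same for all boxes. *)
Lemma multiple_summing_finite (I : finType) (X : I -> normedModType K) (Y : normedModType K)
    (s : R) (qq : I -> R) (T : (forall j, X j) -> Y) (c : R) :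
  (forall j, 1 <= qq j) -> 0 < s -> 0 < c ->
  (forall N (x : forall j, 'I_N.+1 -> X j) (W : I -> R),
    (forall j, weakly_bounded (qq j) (W j) (x j)) ->
    (\sum_(w : {ffun I -> 'I_N.+1}) nrm (T (fun j => x j (w j))) `^ s) `^ s^-1 <=
    c * \prod_j W j) ->
  multiple_summing s qq T.
Proof.
move=> qq1 s0 c0 hT; exists c => // x.
have prod0 : (0 <= \prod_j weak_norm (qq j) (x j))%E.
  by apply: prode_ge0 => j _; exact: weak_norm_ge0.
have V0 : (0 <= c%:E * \prod_j weak_norm (qq j) (x j))%E.
  by rewrite mule_ge0// lee_fin ltW.
rewrite lee_root//; last by apply: esum_ge0 => i _; rewrite lee_fin powR_ge0.
apply: ge_ereal_sup => _ [F [/finite_seqP[F' ->] _] <-].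
pose N := (\max_(w <- F') \max_j w j)%N.
have F'N w j : w \in F' -> (w j < N.+1)%N.
  move=> wF; rewrite ltnS /N (big_rem w)//= (leq_trans _ (leq_maxl _ _))//.
  exact: (leq_bigmax (F := fun j => w j)).
have h j := weakly_bounded_restrict N (x j) (qq1 j).
pose W j := s2val (cid2 (h j)).
have wW j : weakly_bounded (qq j) (W j) (fun i : 'I_N.+1 => x j i) := s2valP (cid2 (h j)).
have Wx j : ((W j)%:E <= weak_norm (qq j) (x j))%E := s2valP' (cid2 (h j)).
have W0 j : 0 <= W j by case: (wW j).
have := hT N (fun j i => x j i) W wW; rewrite -lee_fin -poweR_EFin lee_root//; last 2 first.
- by rewrite lee_fin; apply: sumr_ge0 => i _; exact: powR_ge0.
- by rewrite lee_fin mulr_ge0 ?prodr_ge0// ltW.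
move=> hS; apply: le_trans (le_trans hS _); last first.
  apply: gt0_ler_poweR; rewrite ?in_itv/= ?leey ?andbT ?V0 ?(ltW s0) ?lee_fin//.
    by rewrite mulr_ge0 ?prodr_ge0// ltW.
  rewrite EFinM lee_pmul ?lee_fin ?(ltW c0) ?prodr_ge0//.
  by rewrite -prodEFin; apply: lee_prod => j _; rewrite ?lee_fin.
pose psi (w : {ffun I -> 'I_N.+1}) : {ffun I -> nat} := [ffun j => w j : nat].
have psi_inj : injective psi.
  by move=> a b /ffunP ab; apply/ffunP => j; apply: val_inj; have := ab j; rewrite !ffunE.
rewrite -sumEFin.
have -> : (\sum_(w : {ffun I -> 'I_N.+1}) (nrm (T (fun j => x j (w j))) `^ s)%:E =
    \sum_(i \in [set` map psi (index_enum {ffun I -> 'I_N.+1})]%classic)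
      (nrm (T (fun j => x j (i j))) `^ s)%:E)%E.
  rewrite -fsbig_seq; last by rewrite map_inj_uniq// index_enum_uniq.
  rewrite big_map; apply: eq_bigr => w _; congr ((nrm (T _) `^ s)%:E).
  by apply: functional_extensionality_dep => j; rewrite ffunE.
apply: lee_fsum_nneg_subset; [exact: finite_seq | exact: finite_seq | |].
- move=> w; rewrite !inE /= => wF; apply/mapP.
  exists [ffun j => inord (w j)]; first exact: mem_index_enum.
  by apply/ffunP => j; rewrite !ffunE inordK// F'N.
- by move=> w _; rewrite lee_fin powR_ge0.
Qed.

End FiniteForms.

(** * From weighted mixed norms to the full sum *)

Section WeightedMixedNorms.
Variables (R : realType) (m n N : nat) (C : 'I_n -> {set 'I_m}).
Variables (q : R) (r p : 'I_n -> R) (qq : 'I_m -> R) (J : {set 'I_n}) (k0 : 'I_n) (s : R).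
Hypotheses (hq : 2 <= q) (hr : forall k, 1 <= r k < q) (hp : forall k, 1 <= p k).
Hypotheses (C_disjoint : forall k l, k != l -> [disjoint C k & C l])
  (C_cover : forall j : 'I_m, exists k, j \in C k)
  (hqq : forall k j, j \in C k -> qq j = p k).
Hypotheses (hk0 : k0 \notin J) (h1 : q <= gamma C q r p k0 J)
  (h2 : forall k l, k \notin J -> l \notin J -> k != l ->
     0 < gamma C q r p k (l |: J) <= q)
  (hs : s = ((gamma C q r p k0 J)^-1 - \sum_(j in J) #|C j|%:R * inv_conj (p j))^-1)
  (s_gt0 : 0 < s).
Local Notation O := {ffun 'I_m -> 'I_N.+1}.

Lemma sum_blocks (f : 'I_m -> R) k :
  \sum_(j | j \notin C k) f j = \sum_(l | l != k) \sum_(j in C l) f j.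
Proof.
pose kappa j := xchoose (C_cover j).
have kappaE j l : (j \in C l) = (kappa j == l).
  have jk := xchooseP (C_cover j); rewrite -/(kappa j) in jk.
  apply/idP/eqP => [jl|<-//]; apply/eqP; apply: contraT => kl.
  by have /pred0P/(_ j) := C_disjoint kl; rewrite /= jk jl.
rewrite (partition_big kappa (fun l => l != k)) => [|j].
  apply: eq_bigr => l lk; apply: eq_bigl => j; rewrite !kappaE.
  by case: (eqVneq (kappa j) l) => [->|]; rewrite ?lk ?andbF.
by rewrite kappaE.
Qed.

(** The assumption is applied to the marginals of [P]: the logarithms of these weights average to
    minus the coordinate entropies, which [exists_block] absorbs. *)
Lemma weighted_mixed_norms (b : O -> R) W : (forall w, 0 <= b w) -> 0 <= W ->
  (forall k (Q : 'I_m -> 'I_N.+1 -> R), (forall j i, 0 <= Q j i) ->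
     (forall j, \sum_i Q j i = 1) ->
     \sum_a (\sum_(w | block_restriction (C k) w == a)
        (\prod_(j | j \notin C k) Q j (w j) `^ inv_conj (qq j) * b w) `^ q) `^ (r k / q)
     <= W `^ r k) ->
  (\sum_w b w `^ s) `^ s^-1 <= W.
Proof.
move=> b0 W0 hW.
have q0 : 0 < q by rewrite (lt_le_trans _ hq).
have sn0 := lt0r_neq0 s_gt0; have qn0 := lt0r_neq0 q0.
set Z := \sum_w _.
have [Z0|Zn0] := eqVneq Z 0; first by rewrite Z0 powR0// invr_eq0.
have Zp : 0 < Z by rewrite lt_neqAle eq_sym Zn0 sumr_ge0// => w _; exact: powR_ge0.
pose P w := b w `^ s / Z.
have P0 w : 0 <= P w by rewrite divr_ge0 ?powR_ge0// ltW.
have P1 : \sum_w P w = 1 by rewrite -mulr_suml divff.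
have bP w : P w != 0 -> 0 < b w.
  move=> Pw; rewrite lt_neqAle b0 andbT eq_sym; apply: contraNneq Pw => bw.
  by rewrite /P bw powR0// mul0r.
pose ev (j : 'I_m) (w : O) := w j.
pose Q j := marginal P (ev j).
pose H := entropy P id; pose h k := entropy P (block_restriction (C k)).
have hH k : h k <= H by apply: le_entropy => // w w' ->.
have [k hk] := exists_block hq hr hp hk0 h1 h2 hs hH.
have /andP[r1 rq] := hr k.
have r0 : 0 < r k by lra.
have u01 : 0 < r k / q <= 1 by rewrite divr_gt0// ler_pdivrMr// mul1r ltW.
have Q0 j i : 0 <= Q j i by exact: marginal_ge0.
pose g (w : O) := (\prod_(j | j \notin C k) Q j (w j) `^ inv_conj (qq j) * b w) `^ q.
have QP (w : O) j : P w != 0 -> 0 < Q j (w j) by move=> Pw; exact: (marginal_gt0 P0 (ev j) Pw).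
have prodP (w : O) : P w != 0 -> 0 < \prod_(j | j \notin C k) Q j (w j) `^ inv_conj (qq j).
  by move=> Pw; apply: prodr_gt0 => j _; rewrite powR_gt0 ?QP.
have gP w : P w != 0 -> 0 < g w.
  by move=> Pw; rewrite powR_gt0// mulr_gt0 ?bP// prodP.
have := mixed_norm_entropy (block_restriction (C k)) P0 P1 u01 (fun w => powR_ge0 _ _)
  (fun w Pw => lt0r_neq0 (gP w Pw)).
rewrite -/(h k) -/H; set F := \sum_a _.
have FW : F <= W `^ r k by apply: hW => // j; exact: marginal_sum.
have F0 : 0 < F.
  have [w Pw] : exists w, P w != 0.
    apply: contrapT => no; move: P1; rewrite big1 => [/esym/eqP|w _]; first by rewrite oner_eq0.
    by apply: contrapT => /eqP Pw; apply: no; exists w.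
  rewrite /F (bigD1 (block_restriction (C k) w))//=.
  rewrite ltr_pwDl ?sumr_ge0// => [|a _]; last exact: powR_ge0.
  rewrite powR_gt0// (bigD1 w)//= ltr_pwDl ?gP// sumr_ge0// => w' _; exact: powR_ge0.
have Wp : 0 < W.
  rewrite lt_neqAle W0 andbT eq_sym; apply/eqP => W00.
  by move: (lt_le_trans F0 FW); rewrite W00 powR0 ?ltxx// gt_eqF.
have : ln F <= r k * ln W by rewrite -ln_powR ler_ln ?posrE// powR_gt0.
(* On the support of [P], ln b = (ln P + ln Z) / s, with mean (ln Z - H) / s. *)
have -> : \sum_w P w * ln (g w) =
    q * ((ln Z - H) / s - \sum_(j | j \notin C k) inv_conj (qq j) * entropy P (ev j)).
  have -> : \sum_(j | j \notin C k) inv_conj (qq j) * entropy P (ev j) =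
     - \sum_w P w * \sum_(j | j \notin C k) inv_conj (qq j) * ln (Q j (w j)).
    under [in RHS]eq_bigr do rewrite mulr_sumr.
    rewrite exchange_big -sumrN; apply: eq_bigr => j _ /=.
    by rewrite /entropy mulrN mulr_sumr; congr (- _); apply: eq_bigr => w _; rewrite mulrCA.
  rewrite opprK /H /entropy opprK -[ln Z]mul1r -P1 mulr_suml -big_split /= mulr_suml.
  rewrite -big_split mulr_sumr; apply: eq_bigr => w _ /=.
  have [->|Pw] := eqVneq (P w) 0; first by rewrite !mul0r; ring.
  rewrite marginal_id ln_powR lnM ?posrE ?prodP ?bP//.
  have -> : ln (P w) = s * ln (b w) - ln Z by rewrite ln_div ?posrE ?powR_gt0 ?bP// ln_powR.
  have -> : ln (\prod_(j | j \notin C k) Q j (w j) `^ inv_conj (qq j)) =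
      \sum_(j | j \notin C k) inv_conj (qq j) * ln (Q j (w j)).
    (* Positivity is carried along, as the logarithm of a product needs positive factors. *)
    pose K1 (x y : R) := 0 < x /\ ln x = y.
    suff [] : K1 (\prod_(j | j \notin C k) Q j (w j) `^ inv_conj (qq j))
      (\sum_(j | j \notin C k) inv_conj (qq j) * ln (Q j (w j))) by [].
    apply: (big_ind2 K1); rewrite /K1; first by rewrite ltr01 ln1.
      by move=> x1 y1 x2 y2 [x10 <-] [x20 <-]; rewrite mulr_gt0// lnM ?posrE.
    by move=> j _; rewrite powR_gt0 ?QP// ln_powR.
  by field.
(* A coordinate in [C l] is a function of the restriction to that block, so its entropy is at most
   [h l]; the block has |C_l| coordinates. *)
have : \sum_(j | j \notin C k) inv_conj (qq j) * entropy P (ev j) <=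
       \sum_(l | l != k) #|C l|%:R * inv_conj (p l) * h l.
  rewrite sum_blocks; apply: ler_sum => l _.
  apply: (@le_trans _ _ (\sum_(j in C l) inv_conj (p l) * h l)); last first.
    by rewrite sumr_const -mulrA mulr_natl.
  apply: ler_sum => j jl; rewrite (hqq jl) ler_wpM2l//.
    by rewrite subr_ge0 invf_le1// (lt_le_trans ltr01).
  apply: le_entropy => // w w' /ffunP/(_ j).
  by rewrite !ffunE jl.
move: hk; rewrite -/H; set E := \sum_(l | _) _; set E' := \sum_(j | _) _ => hk EE' lnF ent.
have : ln Z / s <= ln W.
  rewrite -(ler_pM2l r0); move: (le_trans ent lnF); apply: le_trans.
  (* Once [r k] is factored out, the inequality of [exists_block] leaves ln Z / s. *)
  have -> : r k / q * (q * ((ln Z - H) / s - E') + H) + (1 - r k / q) * h k =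
    r k * ((ln Z - H) / s - E' + H / q + ((r k)^-1 - q^-1) * h k).
    by field; rewrite qn0 gt_eqF.
  rewrite ler_pM2l//; move: hk EE'; rewrite mulrBl; lra.
move=> lnZ; rewrite -ler_ln ?posrE ?powR_gt0// ln_powR mulrC//.
Qed.

End WeightedMixedNorms.

(** * Iterated cotype *)

Definition update (I B : finType) (e : {ffun I -> B}) (j : I) (b : B) : {ffun I -> B} :=
  [ffun l => if l == j then b else e l].

(** Exchanging [b] with the j-th entry of [e] is an involution on pairs, so every [e] is hit #|B|
    times. *)
Lemma sum_update (R : realType) (I B : finType) (j : I) (H : {ffun I -> B} -> R) :
  \sum_e \sum_b H (update e j b) = #|B|%:R * \sum_e H e.
Proof.
pose swap (t : {ffun I -> B} * B) := (update t.1 j t.2, t.1 j).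
have swapK : involutive swap.
  move=> [e b]; congr (_, _); last by rewrite /= ffunE eqxx.
  by apply/ffunP => l; rewrite !ffunE; case: eqVneq => [->|].
rewrite pair_big /= (reindex_inj (inv_inj swapK)) /=.
transitivity (\sum_(t : {ffun I -> B} * B) H t.1).
  apply: eq_bigr => t _; congr H.
  by have := congr1 (fun u => u.1) (swapK t).
rewrite -(pair_big xpredT xpredT (fun e b => H e)) /= mulr_sumr.
by apply: eq_bigr => e _; rewrite sumr_const mulr_natl.
Qed.

Section Multilinear.
Variables (R : realType) (k : scalars).
Local Notation K := (scalar_field R k).
Variables (I : finType) (X : I -> normedModType K) (Y : normedModType K).
Variable (T : (forall j, X j) -> Y).
Hypothesis T_lin : multilinear T.
Implicit Types (z : forall j, X j).

Lemma multilinear0 z j : T (dfwith z j 0) = 0.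
Proof.
have := @T_lin z j (-1) 0 0; rewrite scaler0 add0r scaleN1r addNr.
by [].
Qed.

Lemma multilinearD z j u v : T (dfwith z j (u + v)) = T (dfwith z j u) + T (dfwith z j v).
Proof. by rewrite -[u in LHS]scale1r T_lin scale1r. Qed.

Lemma multilinearZ z j (t : K) u : T (dfwith z j (t *: u)) = t *: T (dfwith z j u).
Proof. by rewrite -[t *: u]addr0 T_lin multilinear0 addr0. Qed.

Lemma multilinear_signed_sum z j N (u : 'I_N -> X j) e :
  T (dfwith z j (signed_sum u e)) = signed_sum (fun i => T (dfwith z j (u i))) e.
Proof.
rewrite /signed_sum; elim/big_rec2: _ => [|i y1 y2 _ IH]; first exact: multilinear0.
by rewrite multilinearD multilinearZ IH.
Qed.

End Multilinear.

Section IteratedCotype.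
Variables (R : realType) (k : scalars).
Local Notation K := (scalar_field R k).
Variables (I : finType) (X : I -> normedModType K) (Y : normedModType K).
Variables (T : (forall j, X j) -> Y) (q c : R) (N : nat).
Hypotheses (T_lin : multilinear T) (q1 : 1 <= q) (c0 : 0 < c).
Hypothesis cotypeY : forall N (y : 'I_N -> Y),
  (\sum_(i < N) nrm (y i) `^ q) `^ q^-1 <= c * (2 ^- N * \sum_e nrm (signed_sum y e)).
Variables (x : forall j, 'I_N.+1 -> X j) (A : {set I}).
Local Notation signs := {ffun I -> {ffun 'I_N.+1 -> bool}}.
Local Notation index := {ffun I -> 'I_N.+1}.
Implicit Types (D : {set I}) (e : signs) (w a : index).

Definition randomize D e w : forall j, X j :=
  mix D (fun j => signed_sum (x j) (e j)) (fun j => x j (w j)).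

(** Signs are drawn for all coordinates, also outside [D], so that the index type is the same for
    every [D]. *)
Definition average D w : R := #|signs|%:R^-1 * \sum_e nrm (T (randomize D e w)).

(** The average does not depend on the indices in [D]; freezing them at [ord0] counts each value
    once. *)
Let partial_sum D a := \sum_(w | (block_restriction A w == a) && [forall l in D, w l == ord0])
  average D w `^ q.

Lemma average_ge0 D w : 0 <= average D w.
Proof. by rewrite mulr_ge0 ?invr_ge0 ?sumr_ge0// => e _; exact: nrm_ge0. Qed.

Lemma randomize_update_index D e w j i : j \notin D ->
  randomize D e (update w j i) = dfwith (randomize D e w) j (x j i).
Proof.
move=> jD; apply: functional_extensionality_dep => l; rewrite /randomize /mix.
case: dfwithP => [|l' jl']; first by rewrite (negPf jD) ffunE eqxx.
by rewrite ffunE eq_sym (negPf jl').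
Qed.

Lemma randomize_update_signs D e w j (e' : {ffun 'I_N.+1 -> bool}) :
  randomize (j |: D) (update e j e') w = dfwith (randomize D e w) j (signed_sum (x j) e').
Proof.
apply: functional_extensionality_dep => l; rewrite /randomize /mix.
case: dfwithP => [|l' jl']; first by rewrite !inE eqxx ffunE eqxx.
by rewrite !inE eq_sym (negPf jl') /= ffunE eq_sym (negPf jl').
Qed.

(** Minkowski's inequality moves the l_q norm in [i] inside the average, where cotype applies for
    each choice of the other signs. *)
Lemma cotype_fibre D w j : j \notin D ->
  \sum_i average D (update w j i) `^ q <= (c * average (j |: D) w) `^ q.
Proof.
move=> jD; have q0 : 0 < q by rewrite (lt_le_trans _ q1).
have M0 : 0 <= #|signs|%:R^-1 :> R by rewrite invr_ge0.
have S0 : 0 <= \sum_i average D (update w j i) `^ q.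
  by apply: sumr_ge0 => i _; exact: powR_ge0.
rewrite -[leLHS](@powRVK _ _ q) ?gt_eqF//.
apply: le_powRl; [exact: ltW | exact: powR_ge0 |].
have := @minkowski_sum R _ signs
  (fun i e => #|signs|%:R^-1 * nrm (T (randomize D e (update w j i)))) q q1
  (fun i e => mulr_ge0 M0 (nrm_ge0 _)).
under eq_bigr do rewrite -mulr_sumr; rewrite -/(average D _) => /le_trans; apply.
rewrite /average !mulr_sumr.
(* Resampling the signs of coordinate j does not change the mean. *)
have -> : \sum_e c * (#|signs|%:R^-1 * nrm (T (randomize (j |: D) e w))) =
  \sum_e #|signs|%:R^-1 * (c * (2 ^- N.+1 *
    \sum_e' nrm (T (randomize (j |: D) (update e j e') w)))).
  rewrite -!mulr_sumr (sum_update j (fun e => nrm (T (randomize (j |: D) e w)))).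
  have -> : #|{ffun 'I_N.+1 -> bool}|%:R = 2 ^+ N.+1 :> R.
    by rewrite card_ffun card_bool card_ord natrX.
  by rewrite [2 ^- N.+1 * _]mulKf ?expf_neq0// mulrCA.
apply: ler_sum => e _.
under eq_bigr do rewrite powRM ?nrm_ge0//.
rewrite -mulr_sumr powRM ?powR_ge0 ?sumr_ge0// => [|i _]; last exact: powR_ge0.
rewrite powRKV ?gt_eqF// ler_wpM2l//.
under eq_bigr do rewrite randomize_update_index//.
apply: le_trans (cotypeY _) _.
under eq_bigr do rewrite -multilinear_signed_sum// -randomize_update_signs.
by [].
Qed.

(** Multi-indices are grouped by their value with coordinate j reset to [ord0]; each group is a
    fibre of [cotype_fibre]. *)
Lemma partial_sum_step D a j : j \notin A -> j \notin D ->
  partial_sum D a <= c `^ q * partial_sum (j |: D) a.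
Proof.
move=> jA jD.
rewrite /partial_sum (partition_big (fun w => update w j ord0)
  (fun w => (block_restriction A w == a) && [forall l in j |: D, w l == ord0])) /=.
  rewrite mulr_sumr; apply: ler_sum => w /andP[/eqP wa /forall_inP wD].
  rewrite -powRM ?(ltW c0) ?average_ge0//; apply: le_trans (cotype_fibre w jD).
  rewrite (reindex_onto (fun i => update w j i) (fun w' => w' j)) /=.
    rewrite le_eqVlt; apply/orP; left; apply/eqP/eq_bigl => i.
    rewrite ffunE !eqxx andbT; apply/andP; split; last first.
      apply/eqP/ffunP => l; rewrite !ffunE; case: eqVneq => // ->.
      by rewrite (eqP (wD j _))// !inE eqxx.
    apply/andP; split.
      rewrite -wa; apply/eqP/ffunP => l; rewrite !ffunE; case: ifP => // lA.
      by case: eqVneq lA => // ->; rewrite (negPf jA).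
    apply/forall_inP => l lD; rewrite ffunE.
    by case: (eqVneq l j) lD => [->|_ lD]; [rewrite (negPf jD) | rewrite wD// !inE lD orbT].
  move=> w' /andP[/andP[_ _] /eqP <-]; apply/ffunP => l; rewrite !ffunE.
  by case: eqVneq => // ->.
move=> w /andP[/eqP wa /forall_inP wD]; apply/andP; split.
  rewrite -wa; apply/eqP/ffunP => l; rewrite !ffunE; case: ifP => // lA.
  by case: eqVneq lA => // ->; rewrite (negPf jA).
apply/forall_inP => l; rewrite !inE ffunE; case: (eqVneq l j) => //= _; exact: wD.
Qed.

Lemma partial_sum_iter (s : seq I) a : uniq s -> all (fun j => j \notin A) s ->
  partial_sum finset.set0 a <= (c ^+ size s) `^ q * partial_sum [set j in s] a.
Proof.
elim: s => [_ _|j s IH /= /andP[js us] /andP[jA sA]].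
  rewrite expr0 powR1 mul1r le_eqVlt; apply/orP; left; apply/eqP; congr partial_sum.
have js' : j \notin [set j in s] by rewrite inE.
have cs0 : 0 <= c ^+ size s by rewrite exprn_ge0// ltW.
have := ler_wpM2l (powR_ge0 (c ^+ size s) q) (partial_sum_step a jA js').
move/(le_trans (IH us sA)); rewrite mulrA -powRM ?(ltW c0)// -exprSr.
congr (_ <= _ * partial_sum _ _).
by apply/finset.setP => l; rewrite !inE.
Qed.

Lemma iterated_cotype a : block_restriction A a = a ->
  \sum_(w | block_restriction A w == a) nrm (T (fun j => x j (w j))) `^ q <=
  (c ^+ #|~: A| * average (~: A) a) `^ q.
Proof.
move=> Aa.
have -> : \sum_(w | block_restriction A w == a) nrm (T (fun j => x j (w j))) `^ q =
    partial_sum finset.set0 a.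
  apply: eq_big => [w|w _].
    rewrite (_ : [forall l in _, _] = true) ?andbT//.
    by apply/forall_inP => l; rewrite inE.
  congr (_ `^ q); rewrite /average.
  have E e : T (randomize finset.set0 e w) = T (fun j => x j (w j)).
    by congr T; apply: functional_extensionality_dep => j; rewrite /randomize /mix inE.
  under eq_bigr do rewrite E.
  rewrite sumr_const -[X in _ * X]mulr_natl mulKf// pnatr_eq0 card_ffun -lt0n expn_gt0.
  by rewrite card_ffun expn_gt0 card_bool.
have := @partial_sum_iter (enum (~: A)) a (enum_uniq _).
rewrite -cardE => h; apply: le_trans (h _) _.
  by apply/allP => j; rewrite mem_enum inE.
have -> : [set j in enum (~: A)] = ~: A by apply/finset.setP => j; rewrite inE mem_enum.
rewrite powRM ?exprn_ge0 ?(ltW c0) ?average_ge0// ler_wpM2l ?powR_ge0//.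
(* With all coordinates outside [A] frozen, only w = a is left. *)
rewrite /partial_sum (big_pred1 a)// => w /=; apply/andP/eqP => [[/eqP wa /forall_inP wA]|->].
  rewrite -wa; apply/ffunP => j; rewrite ffunE; case: ifP => // jA.
  by apply/eqP/wA; rewrite inE jA.
split; first exact/eqP.
apply/forall_inP => j; rewrite inE => jA.
by rewrite -Aa ffunE (negPf jA).
Qed.

(* Only the averaged vectors remain, so the mixed norm is controlled by the
   sums over the block alone, uniformly in the signs. *)
Lemma mixed_norm_le r V : 1 <= r -> 0 <= V ->
  (forall e, \sum_(a | block_restriction A a == a) nrm (T (randomize (~: A) e a)) `^ r <= V `^ r) ->
  \sum_a (\sum_(w | block_restriction A w == a) nrm (T (fun j => x j (w j))) `^ q) `^ (r / q) <=
  (c ^+ #|~: A| * V) `^ r.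
Proof.
move=> r1 V0 hV; have q0 : 0 < q by rewrite (lt_le_trans _ q1).
have M0 : (#|signs|%:R : R) != 0.
  by rewrite pnatr_eq0 card_ffun -lt0n expn_gt0 card_ffun expn_gt0 card_bool.
(* Values of [a] that do not vanish off [A] have empty fibres and contribute 0, as r / q > 0. *)
rewrite (bigID (fun a => block_restriction A a == a)) /= [X in _ + X]big1 ?addr0; last first.
  move=> a Aa; rewrite big_pred0 ?powR0 ?gt_eqF ?divr_gt0//; first by lra.
  move=> w; apply: contraNF Aa => /eqP <-.
  by apply/eqP/ffunP => j; rewrite !ffunE; case: ifP => // ->.
apply: (@le_trans _ _ (\sum_(a | block_restriction A a == a)
    (c ^+ #|~: A|) `^ r * (#|signs|%:R^-1 * \sum_e nrm (T (randomize (~: A) e a)) `^ r))).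
  apply: ler_sum => a /eqP Aa.
  have S0 : 0 <= \sum_(w | block_restriction A w == a) nrm (T (fun j => x j (w j))) `^ q.
    by apply: sumr_ge0 => w _; exact: powR_ge0.
  apply: (@le_trans _ _ (((c ^+ #|~: A| * average (~: A) a) `^ q) `^ (r / q))).
    by apply: le_powRl; [rewrite divr_ge0 ?ltW//; lra | | exact: iterated_cotype].
  have cA0 : 0 <= c ^+ #|~: A| by rewrite exprn_ge0// ltW.
  rewrite -powRrM [q * _]mulrCA mulfV ?gt_eqF// mulr1 powRM ?average_ge0// ler_wpM2l ?powR_ge0//.
  rewrite /average !mulr_sumr.
  (* Jensen's inequality takes the power r inside the average over signs. *)
  apply: (@powR_mean R _ (fun=> #|signs|%:R^-1) _ r r1) => [e||e]; last exact: nrm_ge0.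
    by rewrite invr_ge0.
  rewrite sumr_const -[LHS]mulr_natl. by rewrite mulfV.
rewrite powRM ?exprn_ge0 ?(ltW c0)// -mulr_sumr ler_wpM2l ?powR_ge0//.
rewrite -mulr_sumr exchange_big /= ler_pdivrMl ?lt0r ?M0 ?ler0n//.
by rewrite mulr_natl -sumr_const; apply: ler_sum => e _; exact: hV.
Qed.

End IteratedCotype.

(** * Uniform summing constants *)

Section UniformConstants.
Variables (R : realType) (k : scalars).
Local Notation K := (scalar_field R k).
Local Notation rs := (real_scalar R k).
Variables (I : finType) (X : I -> banach R k) (Y : normedModType K).
Variable (T : (forall j, X j) -> Y).
Hypothesis T_lin : multilinear T.

(** The summing inequality is tested on one-term sequences, that is, with a box of side 1. *)
Lemma separately_bounded (A : {set I}) r p j : 1 <= p -> 1 <= r ->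
  coordinatewise_summing A r p T -> j \in A ->
  forall z, exists L, forall u, nrm (T (dfwith z j u)) <= L * nrm u.
Proof.
move=> p1 r1 TA jA z; have r0 : 0 < r by lra.
have [c c0 hc] := coordinatewise_finite p1 r0 TA z.
exists (c * \prod_(l in A | l != j) nrm (z l)) => u.
have := hc 0 (fun l i => if i == ord0 then dfwith z j u l else 0)
  (fun l => nrm (dfwith z j u l)) (fun l _ => weakly_bounded_singleton 0 _ p1).
rewrite (bigD1 [ffun=> ord0]) /=; last by apply/eqP/ffunP => l; rewrite !ffunE if_same.
set S := \sum_(_ | _) _; have S0 : 0 <= S by apply: sumr_ge0 => a _; exact: powR_ge0.
have -> : mix A (fun l => if [ffun=> ord0] l == (ord0 : 'I_1) then dfwith z j u l else 0) z =
    dfwith z j u.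
  apply: functional_extensionality_dep => l; rewrite /mix ffunE eqxx.
  case: ifP => // lA; rewrite dfwithout//.
  by apply: contraFneq lA => <-.
rewrite (bigD1 j)//= dfwithin.
have -> : \prod_(l in A | l != j) nrm (dfwith z j u l) = \prod_(l in A | l != j) nrm (z l).
  by apply: eq_bigr => l /andP[_ lj]; rewrite dfwithout// eq_sym.
set P := \prod_(_ in A | _) _.
have P0 : 0 <= P by apply: prodr_ge0 => l _; exact: nrm_ge0.
move=> h; have {}h : nrm (T (dfwith z j u)) `^ r <= (c * (nrm u * P)) `^ r.
  by move: h; lra.
rewrite -[leLHS](@powRKV _ _ r) ?gt_eqF ?nrm_ge0//.
apply: (@le_trans _ _ (((c * (nrm u * P)) `^ r) `^ r^-1)).
  by apply: le_powRl => //; [rewrite invr_ge0 ltW | exact: powR_ge0].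
rewrite powRKV ?gt_eqF// ?mulr_ge0 ?nrm_ge0 ?(ltW c0)//.
by rewrite -mulrA [P * _]mulrC.
Qed.

(** For each [z] the block sums divided by the product of the [W j] are bounded over all arrays, and
    they are seminorms in each coordinate outside [A]; multilinear uniform boundedness makes the
    bound uniform in [z]. *)
Lemma uniform_constant (A : {set I}) r p : 1 <= p -> 1 <= r ->
  (forall z j, exists L, forall u, nrm (T (dfwith z j u)) <= L * nrm u) ->
  coordinatewise_summing A r p T ->
  exists2 M, 0 <= M & forall z N (x : forall j, 'I_N.+1 -> X j) (W : I -> R),
    (forall j, j \in A -> weakly_bounded p (W j) (x j)) ->
    \sum_(a : {ffun I -> 'I_N.+1} | block_restriction A a == a)
      nrm (T (mix A (fun j => x j (a j)) z)) `^ r <=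
    (M * \prod_(j in A) W j * \prod_(j in ~: A) nrm (z j)) `^ r.
Proof.
move=> p1 r1 T_bnd TA; have r0 : 0 < r by lra.
have rn0 : r != 0 by rewrite gt_eqF.
have ri0 : 0 <= r^-1 by rewrite invr_ge0 ltW.
pose S N (x : forall j, 'I_N.+1 -> X j) (z : forall j, X j) :=
  (\sum_(a : {ffun I -> 'I_N.+1} | block_restriction A a == a)
      nrm (T (mix A (fun j => x j (a j)) z)) `^ r) `^ r^-1.
pose F := [set f | exists N x W, (forall j, j \in A -> weakly_bounded p (W j) (x j)) /\
  f = fun z => @S N x z * (\prod_(j in A) W j)^-1]%classic.
have mix_dfwith (v z : forall j, X j) j u : j \notin A ->
    mix A v (dfwith z j u) = dfwith (mix A v z) j u.
  move=> jA; apply: functional_extensionality_dep => l; rewrite /mix.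
  by case: (dfwithP (mix A v z)) => [|l' jl']; rewrite ?(negPf jA) ?dfwithin// dfwithout.
have sum0 (B : finType) (P : pred B) (f : B -> R) : 0 <= \sum_(a | P a) f a `^ r.
  by apply: sumr_ge0 => a _; exact: powR_ge0.
have prodW0 N (x : forall j, 'I_N.+1 -> X j) (W : I -> R) :
    (forall j, j \in A -> weakly_bounded p (W j) (x j)) -> 0 <= \prod_(j in A) W j.
  by move=> xW; apply: prodr_ge0 => j /xW[].
have semi N (x : forall j, 'I_N.+1 -> X j) z j : j \notin A ->
    bounded_seminorm (fun u => @S N x (dfwith z j u)).
  move=> jA; rewrite /S; split.
  - move=> u v; apply: le_trans (minkowski_cond _ r1 _ _) => [|a|a]; try exact: nrm_ge0.
    apply: le_powRl => //; apply: ler_sum => a _; apply: le_powRl; [exact: ltW | exact: nrm_ge0 |].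
    by rewrite !mix_dfwith// multilinearD// nrmD.
  - move=> t u; rewrite -[in RHS](@powRKV _ `|t| r) ?normr_ge0// -powRM ?powR_ge0//.
    congr (_ `^ _); rewrite mulr_sumr; apply: eq_bigr => a _.
    by rewrite !mix_dfwith// multilinearZ// nrmZr powRM// nrm_ge0.
  (* This bound may depend on [N] and [x]: it only witnesses that the seminorm is bounded. *)
  - have [L hL] := choice (fun a : {ffun I -> 'I_N.+1} => T_bnd (mix A (fun j => x j (a j)) z) j).
    exists ((\sum_(a | block_restriction A a == a) `|L a| `^ r) `^ r^-1) => u.
    rewrite -[nrm u in leRHS](@powRKV _ _ r) ?nrm_ge0// -powRM ?powR_ge0//.
    apply: le_powRl => //; rewrite mulr_suml; apply: ler_sum => a _.
    rewrite -powRM ?nrm_ge0//; apply: le_powRl; [exact: ltW | exact: nrm_ge0 |].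
    by rewrite mix_dfwith// (le_trans (hL _ _))// ler_wpM2r ?nrm_ge0// ler_norm.
have Fs f : F f -> forall z j, j \in enum (~: A) -> bounded_seminorm (fun u => f (dfwith z j u)).
  move=> [N [x [W [xW ->]]]] z j; rewrite mem_enum inE => jA.
  apply: (@bounded_seminorm_scale R k (X j) (fun u => @S N x (dfwith z j u))); last exact: semi.
  by rewrite invr_ge0; exact: prodW0 xW.
have Fb z : exists M, forall f, F f -> f z <= M.
  have [c c0 hc] := coordinatewise_finite p1 r0 TA z.
  exists c => _ [N [x [W [xW ->]]]].
  have P0 := prodW0 _ _ _ xW.
  have [->|Pn0] := eqVneq (\prod_(j in A) W j) 0; first by rewrite invr0 mulr0 ltW.
  rewrite ler_pdivrMr ?lt0r ?Pn0//.
  apply: le_trans (le_powRl ri0 (sum0 _ _ _) (hc N x W xW)) _.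
  by rewrite powRKV// mulr_ge0// ltW.
(* The coordinates in [A] do not affect the sum and are fixed at 0. *)
have [M M0 hM] := multilinear_uniform_boundedness (enum_uniq _) Fs Fb (fun j => 0).
exists M => // z N x W xW.
have P0 := prodW0 _ _ _ xW.
have Z0 : 0 <= \prod_(j in ~: A) nrm (z j) by apply: prodr_ge0 => j _; exact: nrm_ge0.
have [c c0 hc] := coordinatewise_finite p1 r0 TA z.
have [PW|Pn0] := eqVneq (\prod_(j in A) W j) 0.
  by apply: le_trans (hc N x W xW) _; rewrite PW !(mulr0, mul0r).
have := hM _ (ex_intro _ N (ex_intro _ x (ex_intro _ W (conj xW erefl)))) (mix A (fun j => 0) z).
have -> : \prod_(j <- enum (~: A)) nrm (mix A (fun j => 0) z j) = \prod_(j in ~: A) nrm (z j).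
  rewrite big_enum; apply: eq_bigr => j; rewrite inE /mix => /negPf -> //.
have -> : S N x (mix A (fun j => 0) z) = S N x z.
  congr (_ `^ _); apply: eq_bigr => a _; congr (nrm (T _) `^ _).
  by apply: functional_extensionality_dep => j; rewrite /mix; case: (j \in A).
rewrite ler_pdivrMr ?lt0r ?Pn0// mulrAC => h.
have {}h : S N x z <= M * \prod_(j in A) W j * \prod_(j in ~: A) nrm (z j).
  by apply: h => j; rewrite mem_enum inE negbK /mix => ->.
rewrite -[leLHS](@powRVK _ _ r)//; apply: le_powRl => //; first exact: ltW.
exact: powR_ge0.
Qed.

Lemma nrm_multilinear_scale (s : seq I) (t : I -> R) (v : forall j, X j) : uniq s ->
  nrm (T (fun j => if j \in s then rs (t j) *: v j else v j)) =
  \prod_(j <- s) `|t j| * nrm (T v).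
Proof.
elim: s => [_|j s IH /= /andP[js us]].
  by rewrite big_nil mul1r; congr (nrm (T _)); apply: functional_extensionality_dep.
rewrite big_cons -mulrA -IH//.
set w := fun l => if l \in s then rs (t l) *: v l else v l.
have -> : (fun l => if l \in j :: s then rs (t l) *: v l else v l) =
    dfwith w j (rs (t j) *: v j).
  apply: functional_extensionality_dep => l; case: dfwithP => [|l' jl'].
    by rewrite mem_head.
  by rewrite inE eq_sym (negPf jl').
rewrite multilinearZ// nrmZr; congr (_ * nrm (T _)).
apply: functional_extensionality_dep => l; case: dfwithP => // .
by rewrite /w (negPf js).
Qed.

End UniformConstants.

(** * Assembly of the estimates *)

Theorem theorem2p2 (R : realType) (K : scalars) (m n : nat)
    (hm : (2 <= m)%N) (hn : (2 <= n)%N)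
    (C : 'I_n -> {set 'I_m})
    (C_neq0 : forall k, C k != finset.set0)
    (C_disjoint : forall k l, k != l -> [disjoint C k & C l])
    (C_cover : forall j : 'I_m, exists k, j \in C k)
    (Y : banach R K) (q : R) (hq : 2 <= q) (hY : cotype Y q)
    (r p : 'I_n -> R)
    (hr : forall k, 1 <= r k < q) (hp : forall k, 1 <= p k)
    (qq : 'I_m -> R) (hqq : forall k j, j \in C k -> qq j = p k)
    (J : {set 'I_n}) (k0 : 'I_n) (hk0 : k0 \notin J)
    (h1 : q <= gamma C q r p k0 J)
    (h2 : forall k l, k \notin J -> l \notin J -> k != l ->
       0 < gamma C q r p k (l |: J) <= q)
    (h3 : forall k l, k \notin J -> l \notin J -> k != l ->
       #|C l|%:R * gamma C q r p k (l |: J) * inv_conj (p l) <= 1)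
    (s : R)
    (hs : s = ((gamma C q r p k0 J)^-1
                 - \sum_(j in J) #|C j|%:R * inv_conj (p j))^-1)
    (s_gt0 : 0 < s)
    (X : 'I_m -> banach R K) (T : (forall j, X j) -> Y) :
  multilinear T ->
  (forall k, coordinatewise_summing (C k) (r k) (p k) T) ->
  multiple_summing s qq T.
Proof.
move=> T_lin T_sum.
have q1 : 1 <= q by rewrite (le_trans _ hq)// ler1n.
have p1 j : 1 <= qq j by have [k jk] := C_cover j; rewrite (hqq _ _ jk).
have r1 k : 1 <= r k by case/andP: (hr k).
have [c c0 hc] := cotype_L1 hY.
have T_bnd z j : exists L, forall u, nrm (T (dfwith z j u)) <= L * nrm u.
  have [k jk] := C_cover j.
  exact: separately_bounded (hp k) (r1 k) (T_sum k) jk z.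
have unif k := uniform_constant T_lin (hp k) (r1 k) T_bnd (T_sum k).
pose M k := s2val (cid2 (unif k)).
have M0 k : 0 <= M k := s2valP (cid2 (unif k)).
have hM k := s2valP' (cid2 (unif k)).
(* The block is chosen only once the array is known, so the constant has to dominate those of all
   blocks; the 1 makes it positive. *)
pose kappa := 1 + \sum_k c ^+ #|~: C k| * M k.
have cM0 k : 0 <= c ^+ #|~: C k| * M k by rewrite mulr_ge0// exprn_ge0// ltW.
have kappaP k : c ^+ #|~: C k| * M k <= kappa.
  rewrite /kappa (bigD1 k)//= addrCA lerDl addr_ge0// sumr_ge0// => l _; exact: cM0.
have kappa0 : 0 < kappa by rewrite ltr_wpDr// sumr_ge0// => l _; exact: cM0.
apply: (multiple_summing_finite p1 s_gt0 kappa0) => N x W xW.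
have W0 j : 0 <= W j by case: (xW j).
have PW0 : 0 <= \prod_j W j by exact: prodr_ge0.
apply: (weighted_mixed_norms hq hr hp C_disjoint C_cover hqq hk0 h1 h2 hs s_gt0) => //.
- by move=> w; exact: nrm_ge0.
- by rewrite mulr_ge0// ltW.
move=> k Q Q0 Q1.
pose t j i := Q j i `^ inv_conj (qq j).
(* By multilinearity the weights outside [C k] are absorbed into the vectors. *)
pose x' j i := if j \in ~: C k then real_scalar R K (t j i) *: x j i else x j i.
have x'E (w : {ffun 'I_m -> 'I_N.+1}) :
    \prod_(j | j \notin C k) Q j (w j) `^ inv_conj (qq j) * nrm (T (fun j => x j (w j))) =
    nrm (T (fun j => x' j (w j))).
  have := nrm_multilinear_scale T_lin (fun j => t j (w j)) (fun j => x j (w j)) (enum_uniq (~: C k)).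
  have -> : (fun j => if j \in enum (~: C k) then real_scalar R K (t j (w j)) *: x j (w j)
      else x j (w j)) = (fun j => x' j (w j)).
    by apply: functional_extensionality_dep => j; rewrite mem_enum.
  move=> ->; congr (_ * _); rewrite big_enum; apply: eq_big => [j|j _]; first by rewrite inE.
  by rewrite ger0_norm// powR_ge0.
rewrite (eq_bigr (fun a => (\sum_(w | block_restriction (C k) w == a)
    nrm (T (fun j => x' j (w j))) `^ q) `^ (r k / q))) => [|a _]; last first.
  by congr (_ `^ _); apply: eq_bigr => w _; rewrite x'E.
have V0 : 0 <= M k * \prod_j W j by rewrite mulr_ge0.
apply: le_trans (mixed_norm_le T_lin q1 c0 hc (x := x') (A := C k) (r1 k) V0 _) _.
  (* For fixed signs the coordinates outside [C k] are fixed vectors, of norm at most [W j] by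
     [nrm_signed_sum_le], so the uniform constant applies. *)
  move=> e; pose z j := signed_sum (x' j) (e j).
  have randE a : randomize x' (~: C k) e a = mix (C k) (fun j => x j (a j)) z.
    apply: functional_extensionality_dep => j; rewrite /randomize /mix inE.
    by case: ifPn => jC; rewrite ?(negPf jC)// /x' inE (negbNE jC).
  rewrite (eq_bigr (fun a : {ffun 'I_m -> 'I_N.+1} => nrm (T (mix (C k) (fun j => x j (a j)) z)) `^ r k))
    => [|a _]; last by rewrite randE.
  have xWk j : j \in C k -> weakly_bounded (p k) (W j) (x j) by move=> /hqq <-.
  apply: le_trans (hM k z N x W xWk) _.
  have Z0 : 0 <= \prod_(j in ~: C k) nrm (z j) by apply: prodr_ge0 => j _; exact: nrm_ge0.
  have PA0 : 0 <= \prod_(j in C k) W j by exact: prodr_ge0.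
  apply: le_powRl; [by rewrite (le_trans ler01) | exact: mulr_ge0 (mulr_ge0 (M0 k) PA0) Z0 |].
  rewrite -mulrA ler_wpM2l ?M0// [leRHS](bigID (mem (C k))) /= ler_wpM2l//.
  rewrite (eq_bigl (fun j => j \notin C k)) => [|j]; last by rewrite inE.
  apply: ler_prod => j jC; rewrite nrm_ge0 /=.
  have := nrm_signed_sum_le (e j) (p1 j) (xW j) (Q0 j) (Q1 j).
  by rewrite /z /x' inE jC.
apply: le_powRl; [by rewrite (le_trans ler01) | |].
  by rewrite mulr_ge0// exprn_ge0// ltW.
by rewrite mulrA ler_wpM2r.
Qed.
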